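(* Let $\theta(q,x)=\sum_{j=0}^{\infty}q^{j(j+1)/2}x^j$ with $q\in(0,1)$. With the notation of the context, for every $k\geq1$ the even zero $\xi_{2k}$ of $\theta(q,\cdot)$ is an increasing function of $q\in(0,\tilde q_k]$.
   Context: For $q\in(0,1)$, the values of $q$ for which $\theta(q,\cdot)$ has a multiple zero (the spectrum) form a sequence $0<\tilde q_1<\tilde q_2<\cdots$ tending to $1$. For $q\in(0,\tilde q_1)$ all zeros of $\theta(q,\cdot)$ are negative and distinct: $\cdots<\xi_3<\xi_2<\xi_1<0$. They are followed continuously as $q$ increases. For $q=\tilde q_N$ the function $\theta(\tilde q_N,\cdot)$ has exactly one multiple real zero, which is of multiplicity $2$ and is the rightmost of its real zeros, the real zeros being $\cdots<\xi_{2N+2}<\xi_{2N+1}<\xi_{2N}=\xi_{2N-1}<0$; for $q>\tilde q_N$ the zeros $\xi_{2N-1},\xi_{2N}$ have become a complex conjugate pair. In particular, $\xi_{2k}$ is real, continuous and well defined for $q\in(0,\tilde q_k]$. *)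

(* Defs.v *)
(* Stdlib reals with Coquelicot; complex numbers are Coquelicot's C. *)
From Stdlib Require Import Reals Lra Lia.
From Coquelicot Require Import Coquelicot.
Open Scope R_scope.

Definition theta_coef (q : R) (j : nat) : R := q ^ (j * (j + 1) / 2).

(* Coquelicot's Series is real-valued, so the complex series is summed
   componentwise; see theta_is_series. *)
Definition theta (q : R) (z : C) : C :=
  (Series (fun j => theta_coef q j * Re (z ^ j)%C),
   Series (fun j => theta_coef q j * Im (z ^ j)%C)).

(* D n is the n-th complex derivative of f, for n < m. *)
Definition zero_order_ge (f : C -> C) (z : C) (m : nat) : Prop :=
  exists D : nat -> C -> C,
    (forall w, D 0%nat w = f w) /\
    (forall n w, (S n < m)%nat ->
       is_derive (K := C_AbsRing) (V := C_NormedModule) (D n) w (D (S n) w)) /\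
    (forall n, (n < m)%nat -> D n z = 0).

Definition multiple_zero (f : C -> C) (z : C) : Prop := zero_order_ge f z 2.

Definition zero_of_multiplicity (f : C -> C) (z : C) (m : nat) : Prop :=
  zero_order_ge f z m /\ ~ zero_order_ge f z (S m).

Definition spectrum (q : R) : Prop :=
  0 < q < 1 /\ exists z : C, multiple_zero (theta q) z.

(* tq N is the N-th spectral value and xi j q the j-th zero of theta q.  Both
   are indexed from 1: the values tq 0 and xi 0 are junk, as is xi j q for q
   outside (0, 1).  The zeros are complex-valued because xi (2N-1) and xi (2N)
   leave the real axis after tq N. *)
Record theta_zero_labelling (tq : nat -> R) (xi : nat -> R -> C) : Prop := {
  tq_increasing : forall N, (1 <= N)%nat -> tq N < tq (S N);
  tq_spectrum : forall q,
    spectrum q <-> exists N, (1 <= N)%nat /\ q = tq N;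
  tq_lim : is_lim_seq tq 1;

  xi_initial_order : forall q, 0 < q < tq 1%nat -> forall j, (1 <= j)%nat ->
    Im (xi j q) = 0 /\ Re (xi j q) < 0 /\ Re (xi (S j) q) < Re (xi j q);
  xi_initial_all : forall q, 0 < q < tq 1%nat -> forall z : C,
    theta q z = 0 <-> exists j, (1 <= j)%nat /\ z = xi j q;

  xi_zero : forall j q, (1 <= j)%nat -> 0 < q < 1 -> theta q (xi j q) = 0;
  xi_continuous : forall j q, (1 <= j)%nat -> 0 < q < 1 ->
    continuous (xi j) q;

  xi_spectral_double : forall N, (1 <= N)%nat ->
    zero_of_multiplicity (theta (tq N)) (xi (2 * N)%nat (tq N)) 2;
  xi_spectral_unique : forall N (x : R), (1 <= N)%nat ->
    multiple_zero (theta (tq N)) (RtoC x) -> RtoC x = xi (2 * N)%nat (tq N);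
  xi_spectral_merge : forall N, (1 <= N)%nat ->
    xi (2 * N - 1)%nat (tq N) = xi (2 * N)%nat (tq N);
  xi_spectral_order : forall N j, (1 <= N)%nat -> (2 * N <= j)%nat ->
    Im (xi j (tq N)) = 0 /\ Re (xi j (tq N)) < 0 /\
    Re (xi (S j) (tq N)) < Re (xi j (tq N));
  xi_spectral_all : forall N (x : R), (1 <= N)%nat ->
    theta (tq N) (RtoC x) = 0 <->
    exists j, (2 * N <= j)%nat /\ RtoC x = xi j (tq N);

  xi_conjugate : forall N q, (1 <= N)%nat -> tq N < q < 1 ->
    Im (xi (2 * N)%nat q) <> 0 /\
    xi (2 * N - 1)%nat q = Cconj (xi (2 * N)%nat q);

  xi_even_real : forall k q, (1 <= k)%nat -> 0 < q <= tq k ->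
    Im (xi (2 * k)%nat q) = 0
}.

Lemma theta_coef_S (q : R) (j : nat) :
  theta_coef q (S j) = theta_coef q j * q ^ S j.
Proof.
  unfold theta_coef. rewrite <- pow_add. f_equal.
  replace (S j * (S j + 1))%nat with (j * (j + 1) + S j * 2)%nat by ring.
  now rewrite Nat.div_add by easy.
Qed.

Lemma theta_CV_radius (q : R) : 0 < q < 1 -> CV_radius (theta_coef q) = p_infty.
Proof.
  intros Hq.
  assert (H0 : forall n, theta_coef q n <> 0).
  { intros n. unfold theta_coef. apply pow_nonzero. lra. }
  apply CV_radius_infinite_DAlembert; [exact H0|].
  apply is_lim_seq_ext with (fun n => q ^ S n).
  - intros n. rewrite theta_coef_S.
    replace (theta_coef q n * q ^ S n / theta_coef q n) with (q ^ S n)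
      by (field; apply H0).
    symmetry. apply Rabs_pos_eq. apply pow_le. lra.
  - apply is_lim_seq_incr_1 with (u := fun n => q ^ n).
    apply is_lim_seq_geom. rewrite Rabs_pos_eq; lra.
Qed.

Lemma theta_is_series (q : R) (z : C) : 0 < q < 1 ->
  is_series (K := C_AbsRing) (V := C_NormedModule)
    (fun j => (RtoC (theta_coef q j) * z ^ j)%C) (theta q z).
Proof.
  intros Hq.
  assert (Habs : ex_series (fun j => Rabs (theta_coef q j * Cmod z ^ j))).
  { apply CV_disk_inside. rewrite theta_CV_radius by exact Hq. exact I. }
  assert (Hc : forall p : C -> R, (forall w, Rabs (p w) <= Cmod w) ->
    is_series (fun j => theta_coef q j * p (z ^ j)%C)
      (Series (fun j => theta_coef q j * p (z ^ j)%C))).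
  { intros p Hp. apply Series_correct.
    apply (@ex_series_le R_AbsRing R_CompleteNormedModule) with (2 := Habs).
    intros n. change (norm (theta_coef q n * p (z ^ n)%C))
      with (Rabs (theta_coef q n * p (z ^ n)%C)).
    rewrite !Rabs_mult. apply Rmult_le_compat_l; [apply Rabs_pos|].
    rewrite <- Cmod_pow. eapply Rle_trans; [apply Hp | apply Rle_abs]. }
  assert (HRe : forall w, Rabs (Re w) <= Cmod w).
  { intros w. eapply Rle_trans; [apply Rmax_l | apply Rmax_Cmod]. }
  assert (HIm : forall w, Rabs (Im w) <= Cmod w).
  { intros w. eapply Rle_trans; [apply Rmax_r | apply Rmax_Cmod]. }
  specialize (Hc Re HRe) as H1. specialize (Hc Im HIm) as H2.
  assert (Hs : forall n,
    sum_n (G := C_NormedModule) (fun j => (RtoC (theta_coef q j) * z ^ j)%C) n =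
    (sum_n (fun j => theta_coef q j * Re (z ^ j)%C) n,
     sum_n (fun j => theta_coef q j * Im (z ^ j)%C) n)).
  { intros n. induction n as [|n IH].
    - rewrite !sum_O. destruct (z ^ 0)%C as [a b].
      unfold RtoC, Cmult, Re, Im; simpl; f_equal; ring.
    - rewrite !sum_Sn, IH. destruct (z ^ S n)%C as [a b].
      unfold RtoC, Cmult, Re, Im, plus; simpl; unfold Cplus, plus; simpl.
      f_equal; ring. }
  intros P [eps HP].
  pose proof (H1 _ (locally_ball _ eps)) as [N1 HN1].
  pose proof (H2 _ (locally_ball _ eps)) as [N2 HN2].
  exists (Nat.max N1 N2). intros n Hn. apply HP. rewrite Hs.
  split; [apply HN1 | apply HN2]; lia.
Qed.

Lemma theta_real (q x : R) : theta q (RtoC x) = RtoC (PSeries (theta_coef q) x).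
Proof.
  unfold theta, PSeries, RtoC at 3. f_equal.
  - apply Series_ext. intros n. now rewrite <- RtoC_pow.
  - rewrite <- (Rmult_0_l (Series (fun _ => 0))), <- Series_scal_l.
    apply Series_ext. intros n. rewrite <- RtoC_pow. simpl. ring.
Qed.

(* Main.v *)
(** Write [y = -x]. The bilateral series
    [Theta(y) = sum_(j in Z) (-1)^j q^(j (j+1) / 2) y^j = theta(-y) - theta(-1/y) / y]
    satisfies [Theta(y) = -q y Theta(q y)] and, by Jacobi's triple product, is a
    product of linear factors. At a zero of [theta(-y)] with [q^N y = z] in
    [(1, 1/q)], [N] is odd and [Theta(z)] balances an alternating series with
    decreasing terms; the logarithmic derivatives of the product show that
    [Theta] is strongly concave where it decreases. With the heat equation
    [2 q d theta/dq = x d^2 (x theta)/dx^2] this gives: at a zero [x < 0] with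
    [d theta/dx < 0] one has [d theta/dq > 0], so such a zero moves to the right
    when [q] grows. The even zeros satisfy [d theta/dx < 0]: for [q < tq 1] because
    the signs alternate along the ordered simple zeros, and up to [tq k] by
    continuity, since [xi (2k)] is never a multiple zero before [tq k]. *)
Require Import Defs.
From Stdlib Require Import Reals Ranalysis5 Lra Lia.
From Coquelicot Require Import Coquelicot.
Open Scope R_scope.

(** * Entire power series *)

(** Write [D] for [x d/dx]. Alternating series bounds control theta(-t) only for small [t], whereas
    every real zero [-y] has [q y > 1]. The reflection [y -> 1/y] built into Theta leads back to
    small arguments, and the shifts by [q] move Theta itself into one period, where all factors of
    the product are positive. What is wanted at the zero is D^2 theta + D theta > 0; both this and
    the hypothesis D theta > 0 turn into inequalities that are homogeneous in Theta(z) and its first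
    two derivatives. The product can therefore be used in finite form: its normalising constant is
    positive and cancels, its limit never has to be computed, and only coefficients have to
    converge. As functions of [q] the zeros are only known to be continuous, so no derivative of
    [xi] is formed: the motion of a zero is read off from the sign of theta at its old position. *)

Definition entire (a : nat -> R) : Prop :=
  forall x, ex_series (fun j => Rabs (a j * x ^ j)).

Lemma entire_CV_radius (a : nat -> R) : entire a <-> CV_radius a = p_infty.
Proof.
  split; intros H.
  - assert (Hub : forall x, Rbar_le (Finite x) (CV_radius a)).
    { intros x. unfold CV_radius. apply (proj1 (Lub_Rbar_correct (CV_disk a)) x).
      exact (H x). }
    destruct (CV_radius a) as [r| |]; [|reflexivity|].
    + specialize (Hub (r + 1)). simpl in Hub. lra.
    + destruct (Hub 0).
  - intros x. apply CV_disk_inside. rewrite H. exact I.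
Qed.

Lemma theta_coef_entire (q : R) : 0 < q < 1 -> entire (theta_coef q).
Proof. intros Hq. apply entire_CV_radius, theta_CV_radius, Hq. Qed.

Lemma entire_le (a b : nat -> R) :
  (forall j, Rabs (b j) <= Rabs (a j)) -> entire a -> entire b.
Proof.
  intros H Ha x.
  apply (@ex_series_le R_AbsRing R_CompleteNormedModule) with (2 := Ha x).
  intros n. change (Rabs (Rabs (b n * x ^ n)) <= Rabs (a n * x ^ n)).
  rewrite Rabs_Rabsolu, !Rabs_mult.
  apply Rmult_le_compat_r; [apply Rabs_pos | apply H].
Qed.

Lemma entire_ext (a b : nat -> R) :
  (forall j, a j = b j) -> entire a -> entire b.
Proof. intros H. apply entire_le. intros j. rewrite H. lra. Qed.

Lemma entire_ex_series (a : nat -> R) (x : R) :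
  entire a -> ex_series (fun j => a j * x ^ j).
Proof. intros H. apply ex_series_Rabs, H. Qed.

Lemma entire_plus (a b : nat -> R) :
  entire a -> entire b -> entire (fun j => a j + b j).
Proof.
  intros Ha Hb x.
  apply (@ex_series_le R_AbsRing R_CompleteNormedModule)
    with (b := fun j => Rabs (a j * x ^ j) + Rabs (b j * x ^ j)).
  - intros n. change (Rabs (Rabs ((a n + b n) * x ^ n)) <=
                      Rabs (a n * x ^ n) + Rabs (b n * x ^ n)).
    rewrite Rabs_Rabsolu, Rmult_plus_distr_r. apply Rabs_triang.
  - apply (@ex_series_plus R_AbsRing R_NormedModule); [apply Ha | apply Hb].
Qed.

Lemma entire_scal (k : R) (a : nat -> R) :
  entire a -> entire (fun j => k * a j).
Proof.
  intros Ha x.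
  apply ex_series_ext with (fun j => Rabs k * Rabs (a j * x ^ j)).
  - intros n. rewrite <- Rabs_mult. f_equal. ring.
  - apply (@ex_series_scal R_AbsRing R_NormedModule), Ha.
Qed.

(* The coefficients of [x f'(x)] when [f(x) = sum a_j x^j]. *)
Definition euler (a : nat -> R) (j : nat) : R := INR j * a j.

Lemma euler_incr_derive (a : nat -> R) (j : nat) :
  PS_incr_1 (K := R_AbsRing) (V := R_NormedModule) (PS_derive a) j = euler a j.
Proof.
  destruct j as [|j]; unfold euler, PS_derive; simpl PS_incr_1.
  - change (0 = 0 * a 0%nat). ring.
  - reflexivity.
Qed.

Lemma entire_euler (a : nat -> R) : entire a -> entire (euler a).
Proof.
  intros Ha. apply entire_CV_radius.
  rewrite (CV_radius_ext _ _ (fun j => eq_sym (euler_incr_derive a j))).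
  rewrite CV_radius_incr_1, CV_radius_derive. now apply entire_CV_radius.
Qed.

Lemma PSeries_euler (a : nat -> R) (x : R) :
  PSeries (euler a) x = x * PSeries (PS_derive a) x.
Proof.
  rewrite <- PSeries_incr_1. symmetry.
  apply PSeries_ext. apply euler_incr_derive.
Qed.

Lemma is_derive_entire (a : nat -> R) (x : R) :
  entire a -> is_derive (PSeries a) x (PSeries (PS_derive a) x).
Proof.
  intros Ha. apply is_derive_PSeries. apply entire_CV_radius in Ha.
  rewrite Ha. exact I.
Qed.

Lemma PSeries_lin (a b : nat -> R) (k l x : R) : entire a -> entire b ->
  PSeries (fun j => k * a j + l * b j) x = k * PSeries a x + l * PSeries b x.
Proof.
  intros Ha Hb. unfold PSeries. rewrite <- !Series_scal_l.
  rewrite <- Series_plus.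
  - apply Series_ext. intros n. ring.
  - apply (@ex_series_scal R_AbsRing R_NormedModule), entire_ex_series, Ha.
  - apply (@ex_series_scal R_AbsRing R_NormedModule), entire_ex_series, Hb.
Qed.

Lemma PSeries_step (a : nat -> R) (x : R) : entire a ->
  PSeries a x = a 0%nat + x * PSeries (fun j => a (S j)) x.
Proof.
  intros Ha. apply PSeries_decr_1. apply CV_radius_inside.
  apply entire_CV_radius in Ha. rewrite Ha. exact I.
Qed.

Lemma Series_nonneg (u : nat -> R) :
  (forall n, 0 <= u n) -> ex_series u -> 0 <= Series u.
Proof.
  intros H Hu. rewrite <- (Rmult_0_l (Series (fun _ => 0))), <- Series_scal_l.
  apply Series_le; [|exact Hu]. intros n. rewrite Rmult_0_l. split; [lra | apply H].
Qed.

(** Tannery's theorem. The tail [tl K] of the dominating series bounds the tails of all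
    [PSeries (A M) x] at once, and below the cut [K] there are only finitely many terms. It carries
    the inequalities from the finite product to theta. *)
Lemma PSeries_tannery (A : nat -> nat -> R) (a : nat -> R) (x : R) :
  entire a -> (forall M j, Rabs (A M j) <= Rabs (a j)) ->
  (forall j, is_lim_seq (fun M => A M j) (a j)) ->
  is_lim_seq (fun M => PSeries (A M) x) (PSeries a x).
Proof.
  intros Ha HA Hl.
  assert (HAe : forall M, entire (A M)) by (intros M; apply (entire_le a); auto).
  pose (s := fun (b : nat -> R) (K : nat) => Series (fun k => b (S K + k)%nat * x ^ (S K + k))).
  assert (Hsplit : forall b K, entire b ->
    PSeries b x = sum_f_R0 (fun j => b j * x ^ j) K + s b K).
  { intros b K Hb. unfold PSeries, s.
    rewrite (Series_incr_n _ (S K)); [reflexivity | lia | now apply entire_ex_series]. }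
  pose (tl := fun K => Series (fun k => Rabs (a (S K + k)%nat * x ^ (S K + k)))).
  assert (Htl : forall K, ex_series (fun k => Rabs (a (S K + k)%nat * x ^ (S K + k)))).
  { intros K. apply (ex_series_incr_n (fun k => Rabs (a k * x ^ k)) (S K)). apply Ha. }
  assert (Hs : forall b K, (forall j, Rabs (b j) <= Rabs (a j)) -> Rabs (s b K) <= tl K).
  { intros b K Hb.
    assert (Hle : forall k, 0 <= Rabs (b (S K + k)%nat * x ^ (S K + k)) <=
                    Rabs (a (S K + k)%nat * x ^ (S K + k))).
    { intros k. split; [apply Rabs_pos|]. rewrite !Rabs_mult.
      apply Rmult_le_compat_r; [apply Rabs_pos | apply Hb]. }
    eapply Rle_trans; [apply Series_Rabs | apply Series_le; auto].
    apply (@ex_series_le R_AbsRing R_CompleteNormedModule) with (2 := Htl K).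
    intros k. change (Rabs (Rabs (b (S K + k)%nat * x ^ (S K + k))) <=
                      Rabs (a (S K + k)%nat * x ^ (S K + k))).
    rewrite Rabs_Rabsolu. apply Hle. }
  assert (Htail : forall eps, 0 < eps -> exists K, tl K < eps).
  { intros eps Heps.
    pose proof (Series_correct _ (Ha x)) as Hc.
    apply is_lim_seq_Reals in Hc. destruct (Hc eps Heps) as [K HK].
    exists K. specialize (HK K (le_n K)).
    unfold Rdist in HK.
    rewrite (Series_incr_n _ (S K)) in HK; [| lia | apply Ha].
    rewrite sum_n_Reals in HK. simpl pred in HK.
    fold (tl K) in HK. apply Rabs_def2 in HK. lra. }
  assert (Hsum : forall K, is_lim_seq (fun M => sum_f_R0 (fun j => A M j * x ^ j) K)
                             (sum_f_R0 (fun j => a j * x ^ j) K)).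
  { induction K as [|K IH]; simpl.
    - apply is_lim_seq_mult'; [apply Hl | apply is_lim_seq_const].
    - apply is_lim_seq_plus'; [exact IH|].
      apply is_lim_seq_mult'; [apply Hl | apply is_lim_seq_const]. }
  apply is_lim_seq_spec. intros eps.
  destruct (Htail (eps / 3)) as [K HK].
  { destruct eps; simpl; lra. }
  specialize (Hsum K). apply is_lim_seq_spec in Hsum.
  assert (He3 : 0 < eps / 3) by (destruct eps; simpl; lra).
  destruct (Hsum (mkposreal _ He3)) as [M0 HM0].
  exists M0. intros M HM. specialize (HM0 M HM). simpl in HM0.
  rewrite (Hsplit (A M) K (HAe M)), (Hsplit a K Ha).
  pose proof (Hs (A M) K (HA M)) as H1.
  pose proof (Hs a K (fun j => Rle_refl _)) as H2.
  apply Rabs_def2 in HM0.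
  apply Rabs_def1; apply Rabs_le_between in H1; apply Rabs_le_between in H2; lra.
Qed.

(** The partial sums with an even number of terms are sums of nonnegative pairs, and they form a
    subsequence of a convergent sequence. *)
Lemma alternating_nonneg (u : nat -> R) :
  (forall n, 0 <= u (S n) <= u n) -> ex_series (fun n => (-1) ^ n * u n) ->
  0 <= Series (fun n => (-1) ^ n * u n).
Proof.
  intros Hu Hex.
  assert (Hs : forall n, 0 <= sum_n (fun n => (-1) ^ n * u n) (2 * n + 1)).
  { induction n as [|n IH].
    - simpl. rewrite sum_Sn, sum_O. unfold plus; simpl. pose proof (Hu 0%nat). lra.
    - replace (2 * S n + 1)%nat with (S (S (2 * n + 1))) by lia.
      rewrite !sum_Sn. unfold plus; simpl.
      replace ((-1) ^ (n + (n + 0) + 1)) with (-1).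
      + pose proof (Hu (S (n + (n + 0) + 1))). simpl in IH. lra.
      + replace (n + (n + 0) + 1)%nat with (S (2 * n)) by lia.
        now rewrite pow_1_odd. }
  pose proof (Series_correct _ Hex) as Hc.
  assert (Hsub : is_lim_seq (fun n => sum_n (fun n => (-1) ^ n * u n) (2 * n + 1))
            (Series (fun n => (-1) ^ n * u n))).
  { apply (is_lim_seq_subseq (sum_n (fun n => (-1) ^ n * u n)) _ (fun n => (2 * n + 1)%nat)).
    - apply eventually_subseq. intros n. lia.
    - exact Hc. }
  apply (is_lim_seq_le (fun _ => 0) _ 0 _ Hs (is_lim_seq_const 0) Hsub).
Qed.

(** * Finite triple product *)

Fixpoint fsum (f : nat -> R) (n : nat) : R :=
  match n with 0%nat => 0 | S n => fsum f n + f n end.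

Fixpoint fprod (f : nat -> R) (n : nat) : R :=
  match n with 0%nat => 1 | S n => fprod f n * f n end.

Lemma fsum_ext (f g : nat -> R) (n : nat) :
  (forall i, (i < n)%nat -> f i = g i) -> fsum f n = fsum g n.
Proof.
  induction n as [|n IH]; intros H; simpl; [reflexivity|].
  rewrite IH by (intros; apply H; lia). now rewrite H by lia.
Qed.

Lemma fsum_scal (k : R) (f : nat -> R) (n : nat) :
  fsum (fun i => k * f i) n = k * fsum f n.
Proof. induction n as [|n IH]; simpl; [ring | rewrite IH; ring]. Qed.

Lemma fsum_cat (f : nat -> R) (n m : nat) :
  fsum f (n + m) = fsum f n + fsum (fun i => f (n + i)%nat) m.
Proof.
  induction m as [|m IH]; simpl.
  - rewrite Nat.add_0_r. ring.
  - rewrite Nat.add_succ_r. simpl. rewrite IH. ring.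
Qed.

Lemma fsum_head (f : nat -> R) (n : nat) :
  fsum f (S n) = f 0%nat + fsum (fun i => f (S i)) n.
Proof. change (S n) with (1 + n)%nat. rewrite fsum_cat. simpl. ring. Qed.

Lemma fsum_rev (f : nat -> R) (n : nat) :
  fsum f n = fsum (fun i => f (n - S i)%nat) n.
Proof.
  induction n as [|n IH]; [reflexivity|].
  change (fsum f n + f n = fsum (fun i => f (S n - S i)%nat) (S n)).
  rewrite fsum_head, IH. simpl. rewrite Nat.sub_0_r. ring.
Qed.

Lemma fprod_ext (f g : nat -> R) (n : nat) :
  (forall i, (i < n)%nat -> f i = g i) -> fprod f n = fprod g n.
Proof.
  induction n as [|n IH]; intros H; simpl; [reflexivity|].
  rewrite IH by (intros; apply H; lia). now rewrite H by lia.
Qed.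

Lemma fprod_mult (f g : nat -> R) (n : nat) :
  fprod (fun i => f i * g i) n = fprod f n * fprod g n.
Proof. induction n as [|n IH]; simpl; [ring | rewrite IH; ring]. Qed.

Lemma fprod_const (k : R) (n : nat) : fprod (fun _ => k) n = k ^ n.
Proof. induction n as [|n IH]; simpl; [ring | rewrite IH; ring]. Qed.

Lemma fprod_pos (f : nat -> R) (n : nat) :
  (forall i, (i < n)%nat -> 0 < f i) -> 0 < fprod f n.
Proof.
  induction n as [|n IH]; intros H; simpl; [lra|].
  apply Rmult_lt_0_compat; [apply IH; intros|]; apply H; lia.
Qed.

Lemma fprod_cat (f : nat -> R) (n m : nat) :
  fprod f (n + m) = fprod f n * fprod (fun i => f (n + i)%nat) m.
Proof.
  induction m as [|m IH]; simpl.
  - rewrite Nat.add_0_r. ring.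
  - rewrite Nat.add_succ_r. simpl. rewrite IH. ring.
Qed.

Lemma fprod_rev (f : nat -> R) (n : nat) :
  fprod f n = fprod (fun i => f (n - S i)%nat) n.
Proof.
  induction n as [|n IH]; [reflexivity|].
  change (fprod f n * f n = fprod (fun i => f (S n - S i)%nat) (1 + n)).
  rewrite fprod_cat, IH. simpl. rewrite Nat.sub_0_r. ring.
Qed.

(** Lets polynomials be treated as power series, so that the finite product and its limit are values
    of the same [bil]. *)
Lemma PSeries_finite (a : nat -> R) (n : nat) (x : R) :
  (forall j, (n <= j)%nat -> a j = 0) ->
  PSeries a x = fsum (fun j => a j * x ^ j) n.
Proof.
  revert a. induction n as [|n IH]; intros a H.
  - simpl. unfold PSeries. rewrite (Series_ext _ (fun _ => 0 * 0)).
    + rewrite Series_scal_l. ring.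
    + intros j. rewrite H by lia. ring.
  - assert (Hx : ex_series (fun j => a j * x ^ j)).
    { apply (ex_series_incr_n (fun j => a j * x ^ j) (S n)).
      exists 0. apply (is_series_ext (fun _ => 0)).
      - intros j. rewrite H by lia. symmetry. apply Rmult_0_l.
      - change (is_lim_seq (sum_n (fun _ : nat => 0)) 0).
        apply is_lim_seq_ext with (fun _ => 0); [|apply is_lim_seq_const].
        intros k. rewrite sum_n_const. ring. }
    unfold PSeries. rewrite Series_incr_1 by exact Hx.
    rewrite fsum_head. f_equal.
    rewrite (Series_ext _ (fun j => x * (a (S j) * x ^ j))) by (intros; simpl; ring).
    rewrite Series_scal_l. fold (PSeries (fun j => a (S j)) x).
    rewrite (IH (fun j => a (S j))) by (intros; apply H; lia).
    rewrite <- fsum_scal. apply fsum_ext. intros; simpl; ring.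
Qed.

(** * The q-binomial theorem and central Gaussian coefficients *)

Section QBinomial.

Variable q : R.
Hypothesis Hq : 0 < q < 1.

Lemma qpow_pos (n : nat) : 0 < q ^ n.
Proof. apply pow_lt; lra. Qed.

Lemma qpow_S_lt_1 (n : nat) : q ^ S n < 1.
Proof.
  pose proof (pow_lt_1_compat q (S n)) as H. apply H; [lra | lia].
Qed.

Lemma qpow_le_1 (n : nat) : q ^ n <= 1.
Proof. destruct n; [simpl; lra | apply Rlt_le, qpow_S_lt_1]. Qed.

(** The Gaussian binomial coefficient of [n] and [k] times [(-1)^k q^(k (k-1) / 2)], given by its
    Pascal rule; [qexp_closed] is the quotient formula. *)
Fixpoint qexp (n k : nat) : R :=
  match n, k with
  | _, 0%nat => 1
  | 0%nat, S _ => 0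
  | S n, S k => qexp n (S k) - q ^ n * qexp n k
  end.

Lemma qexp_0 (n : nat) : qexp n 0 = 1.
Proof. destruct n; reflexivity. Qed.

Lemma qexp_gt (n k : nat) : (n < k)%nat -> qexp n k = 0.
Proof.
  revert k. induction n as [|n IH]; intros [|k] H; try lia; [reflexivity|].
  simpl. rewrite !IH by lia. ring.
Qed.

Lemma fprod_qexp (u : R) (n : nat) :
  fprod (fun m => 1 - q ^ m * u) n = fsum (fun k => qexp n k * u ^ k) (S n).
Proof.
  induction n as [|n IH]; [simpl; ring|].
  assert (H : forall K, fsum (fun k => qexp (S n) k * u ^ k) (S K) =
    fsum (fun k => qexp n k * u ^ k) (S K) -
    q ^ n * u * fsum (fun k => qexp n k * u ^ k) K).
  { induction K as [|K IHK].
    - simpl. rewrite qexp_0. ring.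
    - change (fsum (fun k => qexp (S n) k * u ^ k) (S (S K))) with
        (fsum (fun k => qexp (S n) k * u ^ k) (S K) + qexp (S n) (S K) * u ^ S K).
      rewrite IHK. simpl. ring. }
  rewrite H. change (fprod (fun m => 1 - q ^ m * u) (S n)) with
    (fprod (fun m => 1 - q ^ m * u) n * (1 - q ^ n * u)).
  rewrite IH. set (s := fsum _ (S n)).
  change (fsum (fun k => qexp n k * u ^ k) (S (S n))) with
    (s + qexp n (S n) * u ^ S n).
  rewrite qexp_gt by lia. ring.
Qed.

Definition qfac (n : nat) : R := fprod (fun i => 1 - q ^ S i) n.

Lemma qfac_S (n : nat) : qfac (S n) = qfac n * (1 - q ^ S n).
Proof. reflexivity. Qed.

Lemma qfac_pos (n : nat) : 0 < qfac n.
Proof.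
  apply fprod_pos. intros i _. pose proof (qpow_S_lt_1 i). lra.
Qed.

(** This is [(-1)^k q^(k (k-1) / 2)]; as a product it obeys its rules without any division of
    exponents. *)
Definition qsign (k : nat) : R := fprod (fun i => - q ^ i) k.

Lemma qsign_S (k : nat) : qsign (S k) = qsign k * - q ^ k.
Proof. reflexivity. Qed.

Lemma qsign_add (n k : nat) : qsign (n + k) = qsign n * qsign k * q ^ (n * k).
Proof.
  induction k as [|k IH].
  - rewrite Nat.add_0_r, Nat.mul_0_r. unfold qsign. simpl. ring.
  - rewrite Nat.add_succ_r, !qsign_S, IH, Nat.mul_succ_r, !pow_add. ring.
Qed.

Lemma qsign_neq_0 (k : nat) : qsign k <> 0.
Proof.
  induction k as [|k IH]; [unfold qsign; simpl; lra|].
  rewrite qsign_S. pose proof (qpow_pos k) as Hk. intros H.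
  apply Rmult_integral in H. destruct H; [auto | lra].
Qed.

Lemma qsign_square (k : nat) : qsign k * qsign k * q ^ k = q ^ (k * k).
Proof.
  induction k as [|k IH]; [unfold qsign; simpl; ring|].
  rewrite qsign_S. replace (S k * S k)%nat with (k * k + k + k + 1)%nat by ring.
  rewrite !pow_add, <- IH. simpl. ring.
Qed.

Lemma qsign_theta_coef (k : nat) :
  qsign k * q ^ k = (-1) ^ k * theta_coef q k.
Proof.
  induction k as [|k IH]; [unfold qsign, theta_coef; simpl; ring|].
  rewrite qsign_S, theta_coef_S. simpl.
  replace (qsign k * - q ^ k * (q * q ^ k)) with
    (- (q * q ^ k) * (qsign k * q ^ k)) by ring.
  rewrite IH. ring.
Qed.

(** Induction along the Pascal rule, which closes by [(1 - q^(d+1)) + q^(d+1) (1 - q^(k+1)) = 1 -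
    q^(k+d+2)]. The case [d = 0] is separate because the first Pascal term vanishes there. *)
Lemma qexp_closed (k d : nat) :
  qexp (k + d) k * qfac k * qfac d = qsign k * qfac (k + d).
Proof.
  assert (H : forall n k d, (k + d)%nat = n ->
    qexp n k * qfac k * qfac d = qsign k * qfac n); [|now apply H].
  clear k d. induction n as [|n IH]; intros k d Hn.
  - replace k with 0%nat by lia. replace d with 0%nat by lia.
    unfold qfac, qsign; simpl. ring.
  - destruct k as [|k].
    + simpl in Hn. subst d. change (qfac 0) with 1. change (qsign 0) with 1.
      rewrite qexp_0. ring.
    + simpl qexp. destruct d as [|d].
      * rewrite qexp_gt by lia.
        assert (Hk : k = n) by lia. subst k.
        pose proof (IH n 0%nat ltac:(lia)) as H0.
        rewrite !qfac_S, qsign_S.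
        replace ((0 - q ^ n * qexp n n) * (qfac n * (1 - q ^ S n)) * qfac 0) with
          (- q ^ n * (1 - q ^ S n) * (qexp n n * qfac n * qfac 0)) by ring.
        rewrite H0. ring.
      * pose proof (IH (S k) d ltac:(lia)) as H1.
        pose proof (IH k (S d) ltac:(lia)) as H2.
        replace ((qexp n (S k) - q ^ n * qexp n k) * qfac (S k) * qfac (S d)) with
          (qexp n (S k) * qfac (S k) * qfac d * (1 - q ^ S d) -
           q ^ n * (1 - q ^ S k) * (qexp n k * qfac k * qfac (S d)))
          by (rewrite !qfac_S; ring).
        rewrite H1, H2, (qfac_S n), qsign_S.
        replace (q ^ S n) with (q * q ^ k * q ^ S d)
          by (rewrite <- Hn, pow_add; simpl; ring).
        replace (q ^ n) with (q ^ k * q ^ S d)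
          by (rewrite <- pow_add; f_equal; lia).
        simpl. ring.
Qed.

(* The normalised central q-binomial coefficients
   [binom(2M, M+j)_q / binom(2M, M)_q]; the truncated [M - j] makes them
   vanish for [j > M]. *)
Fixpoint qb (M j : nat) : R :=
  match j with
  | 0%nat => 1
  | S j => qb M j * ((1 - q ^ (M - j)) / (1 - q ^ (M + S j)))
  end.

Lemma qb_factor (M j : nat) :
  0 <= (1 - q ^ (M - j)) / (1 - q ^ (M + S j)) <= 1.
Proof.
  assert (H1 : 0 < 1 - q ^ (M + S j)).
  { rewrite Nat.add_succ_r. pose proof (qpow_S_lt_1 (M + j)). lra. }
  assert (H2 : q ^ (M + S j) <= q ^ (M - j)).
  { replace (M + S j)%nat with ((M - j) + (M + S j - (M - j)))%nat by lia.
    rewrite pow_add. rewrite <- (Rmult_1_r (q ^ (M - j))) at 2.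
    apply Rmult_le_compat_l; [apply Rlt_le, qpow_pos | apply qpow_le_1]. }
  pose proof (qpow_le_1 (M - j)) as H3. split.
  - apply Rdiv_le_0_compat; lra.
  - apply Rle_div_l; [exact H1 | lra].
Qed.

(** Dividing by the central coefficient makes the weights at most 1 and, by [qb_lim], convergent to
    1: these are the domination and the termwise limit that [PSeries_tannery] asks for. *)
Lemma qb_bound (M j : nat) : 0 <= qb M j <= 1.
Proof.
  induction j as [|j IH]; simpl; [lra|]. pose proof (qb_factor M j).
  split; [apply Rmult_le_pos; lra|].
  apply Rle_trans with (1 * 1); [apply Rmult_le_compat; lra | lra].
Qed.

Lemma qb_gt (M j : nat) : (M < j)%nat -> qb M j = 0.
Proof.
  induction j as [|j IH]; [lia|]. intros H. simpl.
  destruct (Nat.eq_dec M j) as [->|Hj].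
  - rewrite Nat.sub_diag. simpl. unfold Rdiv. ring.
  - rewrite IH by lia. ring.
Qed.

Lemma qb_closed (M j : nat) : (j <= M)%nat ->
  qb M j * (qfac (M + j) * qfac (M - j)) = qfac M * qfac M.
Proof.
  induction j as [|j IH]; intros H.
  - rewrite Nat.add_0_r, Nat.sub_0_r. simpl. ring.
  - rewrite <- IH by lia. simpl qb.
    replace (M - j)%nat with (S (M - S j)) by lia.
    rewrite Nat.add_succ_r, !qfac_S.
    field. pose proof (qpow_S_lt_1 (M + j)). lra.
Qed.

Lemma qb_lim (j : nat) : is_lim_seq (fun M => qb M j) 1.
Proof.
  induction j as [|j IH]; [apply is_lim_seq_const|].
  assert (Hg : is_lim_seq (fun n => q ^ n) 0).
  { apply is_lim_seq_geom. rewrite Rabs_pos_eq; lra. }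
  assert (H1 : is_lim_seq (fun M => q ^ (M - j)) 0).
  { apply is_lim_seq_incr_n with j.
    apply is_lim_seq_ext with (2 := Hg). intros n. f_equal. lia. }
  assert (H2 : is_lim_seq (fun M => q ^ (M + S j)) 0).
  { now apply is_lim_seq_incr_n with (u := fun n => q ^ n). }
  replace (Finite 1) with (Finite (1 * ((1 - 0) / (1 - 0)))) by (f_equal; field).
  simpl. apply is_lim_seq_mult'; [exact IH|].
  apply is_lim_seq_div'; [| | lra];
    apply is_lim_seq_minus'; auto; apply is_lim_seq_const.
Qed.

End QBinomial.

(** * Bilateral series and the triple product for finite M *)

Lemma fprod_inv (f : nat -> R) (n : nat) :
  fprod (fun i => / f i) n = / fprod f n.
Proof.
  induction n as [|n IH]; simpl; [now rewrite Rinv_1|].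
  now rewrite IH, Rinv_mult.
Qed.

(* [sum_j A_j (-z)^j - sum_l B_l (-1)^l z^(-l-1)]; for [A = B = theta_coef q]
   this is Jacobi's bilateral theta series in [-z]. *)
Definition bil (A B : nat -> R) (z : R) : R :=
  PSeries A (- z) - / z * PSeries B (- / z).

(* The exponents attached to [B] in [bil] are the [-l-1]. *)
Definition neuler (B : nat -> R) (l : nat) : R := - (INR (S l) * B l).

Lemma neuler_alt (B : nat -> R) (l : nat) :
  neuler B l = -1 * euler B l + -1 * B l.
Proof. unfold neuler, euler. rewrite S_INR. ring. Qed.

Lemma entire_neuler (B : nat -> R) : entire B -> entire (neuler B).
Proof.
  intros HB. eapply entire_ext; [intros j; symmetry; apply neuler_alt|].
  apply entire_plus; apply entire_scal; [now apply entire_euler | exact HB].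
Qed.

(** The operator [z d/dz] multiplies each coefficient by its exponent, so it maps bilateral series
    to bilateral series. *)
Lemma is_derive_bil (A B : nat -> R) (z : R) :
  entire A -> entire B -> z <> 0 ->
  is_derive (bil A B) z (bil (euler A) (neuler B) z / z).
Proof.
  intros HA HB Hz. unfold bil.
  rewrite (PSeries_ext (neuler B) _ _ (neuler_alt B)).
  rewrite PSeries_lin by (auto; now apply entire_euler).
  rewrite !PSeries_euler.
  pose proof (is_derive_entire A (- z) HA) as DA.
  pose proof (is_derive_entire B (- / z) HB) as DB.
  auto_derive.
  - split; [eexists; exact DA|]. split; [exact Hz|].
    split; [eexists; exact DB | auto].
  - rewrite (is_derive_unique (fun x : R => PSeries A x) _ _ DA).
    rewrite (is_derive_unique (fun x : R => PSeries B x) _ _ DB).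
    field. exact Hz.
Qed.

Section TripleProduct.

Variable q : R.
Hypothesis Hq : 0 < q < 1.

Definition trA (M j : nat) : R := qb q M j * theta_coef q j.
Definition trB (M l : nat) : R := qb q M (S l) * theta_coef q l.

Definition triple (M : nat) (z : R) : R :=
  fprod (fun i => (1 - q ^ S i * z) * (1 - q ^ i / z)) M.

Let qn0 (n : nat) : q ^ n <> 0.
Proof. pose proof (qpow_pos q Hq n). lra. Qed.

(** The hypothesis on [x] says that it is the Gaussian coefficient of [2M] and [k] divided by the
    central one. The form serves both halves of the expansion, [k >= M] and [k < M]. *)
Lemma qexp_central (M k d : nat) (x : R) : (k + d = M + M)%nat ->
  x * (qfac q k * qfac q d) = qfac q M * qfac q M ->
  qexp q (M + M) k * qsign q M = qexp q (M + M) M * qsign q k * x.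
Proof.
  intros Hkd Hx.
  pose proof (qfac_pos q Hq k). pose proof (qfac_pos q Hq d).
  pose proof (qfac_pos q Hq M).
  pose proof (qexp_closed q k d) as HE1. rewrite Hkd in HE1.
  pose proof (qexp_closed q M M) as HE2.
  apply (Rmult_eq_reg_r (qfac q k * qfac q d)).
  2:{ apply Rmult_integral_contrapositive; split; lra. }
  transitivity (qexp q (M + M) k * qfac q k * qfac q d * qsign q M); [ring|].
  rewrite HE1.
  transitivity (qexp q (M + M) M * qsign q k * (x * (qfac q k * qfac q d))).
  - rewrite Hx.
    replace (qexp q (M + M) M * qsign q k * (qfac q M * qfac q M)) with
      (qsign q k * (qexp q (M + M) M * qfac q M * qfac q M)) by ring.
    rewrite HE2. ring.
  - ring.
Qed.

(** The q-binomial theorem with [2M] factors, centred by the choice [u = q z / q^M]. The factors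
    with [m = M + i] become [1 - q^(i+1) z]; those with [m = M - 1 - i] become [1 - q^i / z] once
    [- z / q^i] is taken out. In the expansion, [k = M + j] yields [trA] and [k = M - 1 - l] yields
    [trB]. *)
Lemma triple_product (M : nat) (z : R) : 0 < z ->
  bil (trA M) (trB M) z = qfac q M * qfac q M / qfac q (M + M) * triple M z.
Proof.
  intros Hz.
  pose (u := q * z / q ^ M).
  pose (C := qexp q (M + M) M).
  pose proof (qsign_neq_0 q Hq) as Hs.
  pose proof (fun n => Rgt_not_eq _ _ (qfac_pos q Hq n)) as Hf.
  assert (Hu : forall j, u ^ j = q ^ j * z ^ j / q ^ (M * j)).
  { intros j. unfold u, Rdiv. now rewrite !Rpow_mult_distr, pow_inv, pow_mult. }
  assert (Hz0 : forall j, z ^ j <> 0) by (intros; apply pow_nonzero; lra).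
  assert (HA : fsum (fun k => qexp q (M + M) (M + k) * u ^ (M + k)) (S M) =
               C * u ^ M * PSeries (trA M) (- z)).
  { rewrite (PSeries_finite _ (S M)).
    2:{ intros j Hj. unfold trA. rewrite qb_gt by lia. ring. }
    rewrite <- fsum_scal. apply fsum_ext. intros j Hj.
    pose proof (qexp_central M (M + j) (M - j) (qb q M j) ltac:(lia)
      (qb_closed q Hq M j ltac:(lia))) as H.
    rewrite qsign_add in H.
    apply (Rmult_eq_reg_r (qsign q M)); [|apply Hs].
    replace (qexp q (M + M) (M + j) * u ^ (M + j) * qsign q M) with
      (qexp q (M + M) (M + j) * qsign q M * u ^ (M + j)) by ring.
    rewrite H. fold C. rewrite pow_add, (Hu j). unfold trA.
    replace (- z) with (-1 * z) by ring. rewrite Rpow_mult_distr.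
    transitivity (C * u ^ M * qsign q M * qb q M j * z ^ j * (qsign q j * q ^ j)).
    - field. apply qn0.
    - rewrite qsign_theta_coef. ring. }
  assert (HB : fsum (fun k => qexp q (M + M) k * u ^ k) M =
               C * u ^ M * (- / z * PSeries (trB M) (- / z))).
  { rewrite (PSeries_finite _ M).
    2:{ intros j Hj. unfold trB. rewrite qb_gt by lia. ring. }
    rewrite fsum_rev, <- !fsum_scal. apply fsum_ext. intros l Hl.
    pose (k := (M - S l)%nat). fold k.
    pose proof (qb_closed q Hq M (S l) ltac:(lia)) as Hb. fold k in Hb.
    rewrite (Rmult_comm (qfac q (M + S l))) in Hb.
    pose proof (qexp_central M k (M + S l) _ ltac:(lia) Hb) as H.
    fold C in H.
    assert (HM : M = (k + S l)%nat) by lia.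
    apply (Rmult_eq_reg_r (qsign q M)); [|apply Hs].
    replace (qexp q (M + M) k * u ^ k * qsign q M) with
      (qexp q (M + M) k * qsign q M * u ^ k) by ring.
    rewrite H. unfold trB.
    replace (qsign q M) with (qsign q k * qsign q (S l) * q ^ (k * S l))
      by (rewrite <- qsign_add; f_equal; lia).
    replace (u ^ M) with (u ^ k * u ^ S l) by (rewrite <- pow_add; f_equal; lia).
    rewrite (Hu (S l)).
    replace (q ^ (M * S l)) with (q ^ (k * S l) * q ^ (S l * S l))
      by (rewrite <- pow_add; f_equal; rewrite HM; ring).
    rewrite <- (qsign_square q (S l)).
    replace (- / z) with (-1 * / z) at 2 by ring.
    rewrite Rpow_mult_distr, pow_inv.
    transitivity (C * qsign q k * qb q M (S l) * u ^ k *
                  ((-1) ^ l * theta_coef q l) / (qsign q l * q ^ l)).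
    - rewrite <- qsign_theta_coef. field. split; [apply qn0 | apply Hs].
    - rewrite qsign_S. simpl (z ^ S l). field.
      repeat split; try apply qn0; try apply Hs; try apply Hz0; lra. }
  assert (HP : fprod (fun m => 1 - q ^ m * u) (M + M) = z ^ M / qsign q M * triple M z).
  { rewrite fprod_cat, fprod_rev.
    rewrite (fprod_ext (fun i => 1 - q ^ (M + i) * u) (fun i => 1 - q ^ S i * z)).
    2:{ intros i _. unfold u. rewrite pow_add. simpl. field. apply qn0. }
    rewrite (fprod_ext (fun i => 1 - q ^ (M - S i) * u)
               (fun i => (z * / - q ^ i) * (1 - q ^ i / z))).
    2:{ intros i Hi. unfold u. replace (q ^ M) with (q ^ (M - S i) * q ^ S i)
          by (rewrite <- pow_add; f_equal; lia).
        simpl. field. repeat split; try apply qn0; lra. }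
    rewrite !fprod_mult, fprod_const, fprod_inv. fold (qsign q M).
    unfold triple. rewrite fprod_mult. unfold Rdiv. ring. }
  rewrite fprod_qexp in HP.
  replace (S (M + M)) with (M + S M)%nat in HP by lia.
  rewrite fsum_cat, HA, HB in HP.
  assert (HC : C * qfac q M * qfac q M = qsign q M * qfac q (M + M)) by apply qexp_closed.
  assert (HC0 : C = qsign q M * qfac q (M + M) / (qfac q M * qfac q M)).
  { rewrite <- HC. field. apply Hf. }
  rewrite HC0, Hu, <- qsign_square in HP. unfold bil.
  pose proof (qn0 M). pose proof (Hs M). pose proof (Hf M). pose proof (Hf (M + M)%nat).
  pose proof (Hz0 M).
  apply (Rmult_eq_reg_l (qsign q M * qfac q (M + M) / (qfac q M * qfac q M) *
        (q ^ M * z ^ M / (qsign q M * qsign q M * q ^ M)))).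
  - transitivity (z ^ M / qsign q M * triple M z).
    + rewrite <- HP. ring.
    + field. auto.
  - apply Rmult_integral_contrapositive. split; apply Rmult_integral_contrapositive; split;
      try apply Rinv_neq_0_compat; repeat apply Rmult_integral_contrapositive_currified; auto.
Qed.

(** [vterm i] is [z d/dz] of [log (1 - q^i / z)], and [wterm i] is minus [z d/dz] of
    [log (1 - q^(i+1) z)]. Thus [dlog] is [z d/dz] of the logarithm of [triple], and [dlog2] is
    minus [z d/dz] of [dlog]. *)
Definition vterm (i : nat) (z : R) : R := q ^ i / (z - q ^ i).
Definition wterm (i : nat) (z : R) : R := q ^ S i * z / (1 - q ^ S i * z).

Definition dlog (M : nat) (z : R) : R :=
  fsum (fun i => vterm i z - wterm i z) M.
Definition dlog2 (M : nat) (z : R) : R :=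
  fsum (fun i => vterm i z * (1 + vterm i z) + wterm i z * (1 + wterm i z)) M.

Lemma annulus_factors (z : R) (i : nat) : 1 < z -> q * z < 1 ->
  0 < z - q ^ i /\ 0 < 1 - q ^ S i * z.
Proof.
  intros H1 H2. pose proof (qpow_le_1 q Hq i). pose proof (qpow_pos q Hq i).
  simpl. split; [lra|]. nra.
Qed.

Lemma triple_pos (M : nat) (z : R) : 1 < z -> q * z < 1 -> 0 < triple M z.
Proof.
  intros H1 H2. apply fprod_pos. intros i _.
  destruct (annulus_factors z i H1 H2) as [Ha Hb].
  replace (1 - q ^ i / z) with ((z - q ^ i) / z) by (field; lra).
  apply Rmult_lt_0_compat; [exact Hb | apply Rdiv_lt_0_compat; lra].
Qed.

Lemma is_derive_triple (M : nat) (z : R) : 1 < z -> q * z < 1 ->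
  is_derive (triple M) z (triple M z * dlog M z / z).
Proof.
  intros H1 H2. induction M as [|M IH].
  - unfold triple, dlog; simpl. replace (1 * 0 / z) with 0 by (field; lra).
    apply (@is_derive_const R_AbsRing).
  - destruct (annulus_factors z M H1 H2) as [Ha Hb].
    apply is_derive_ext with
      (fun t => triple M t * ((1 - q ^ S M * t) * (1 - q ^ M / t))); [reflexivity|].
    change (triple (S M) z) with (triple M z * ((1 - q ^ S M * z) * (1 - q ^ M / z))).
    change (dlog (S M) z) with (dlog M z + (vterm M z - wterm M z)).
    unfold vterm, wterm.
    auto_derive.
    + split; [eexists; exact IH | lra].
    + rewrite (is_derive_unique (fun x : R => triple M x) _ _ IH). simpl (q ^ S M) in *.
      field. repeat split; lra.
Qed.

Lemma is_derive_dlog (M : nat) (z : R) : 1 < z -> q * z < 1 ->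
  is_derive (dlog M) z (- dlog2 M z / z).
Proof.
  intros H1 H2. induction M as [|M IH].
  - unfold dlog2, dlog; simpl. replace (- 0 / z) with 0 by (field; lra).
    apply (@is_derive_const R_AbsRing).
  - destruct (annulus_factors z M H1 H2) as [Ha Hb].
    apply is_derive_ext with
      (fun t => dlog M t + (q ^ M / (t - q ^ M) - q ^ S M * t / (1 - q ^ S M * t)));
      [reflexivity|].
    change (dlog2 (S M) z) with (dlog2 M z +
      (vterm M z * (1 + vterm M z) + wterm M z * (1 + wterm M z))).
    unfold vterm, wterm.
    auto_derive.
    + simpl in Hb. split; [eexists; exact IH |].
      repeat split; apply Rgt_not_eq; lra.
    + rewrite (is_derive_unique (fun x : R => dlog M x) _ _ IH). simpl (q ^ S M) in *.
      field. repeat split; lra.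
Qed.

End TripleProduct.

(** * Concavity of the bilateral series for 1 < z < 1/q *)

Lemma fsum_plus (f g : nat -> R) (n : nat) :
  fsum (fun i => f i + g i) n = fsum f n + fsum g n.
Proof. induction n as [|n IH]; simpl; [ring | rewrite IH; ring]. Qed.

Lemma fsum_le (f g : nat -> R) (n : nat) :
  (forall i, f i <= g i) -> fsum f n <= fsum g n.
Proof.
  intros H. induction n as [|n IH]; simpl; [lra | specialize (H n); lra].
Qed.

Lemma fsum_nonneg (f : nat -> R) (n : nat) :
  (forall i, 0 <= f i) -> 0 <= fsum f n.
Proof.
  intros H. induction n as [|n IH]; simpl; [lra | specialize (H n); lra].
Qed.

Section Concavity.

Variable q : R.
Hypothesis Hq : 0 < q < 1.

(* [gap] bounds [vterm 0] from below. [slope] and [curv] are what makes the terms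
   of the alternating series in [principal_part_slope] and [principal_part_curv]
   decrease. *)
Definition gap : R := q / (1 - q).
Definition slope : R := q ^ 2 / (1 - q ^ 2).
Definition curv : R := 2 * gap + gap ^ 2 - slope ^ 2.

(** In the sums below, the left side is [(V - W)^2 - 2 V - V2 - W2]. Since [V >= gap] and
    [V2 >= gap^2], it remains to see that [(V - W)^2 - W2 <= slope^2]. The index [S M] guarantees
    that the terms with [i = 0] are present. *)
Lemma dlog_concave (M : nat) (z : R) : 1 < z -> q * z < 1 ->
  dlog q (S M) z <= slope ->
  dlog q (S M) z ^ 2 - dlog2 q (S M) z - dlog q (S M) z <= - curv.
Proof.
  intros H1 H2 Hd.
  assert (Hv : forall i, 0 <= vterm q i z).
  { intros i. destruct (annulus_factors q Hq z i H1 H2).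
    apply Rdiv_le_0_compat; [apply Rlt_le, qpow_pos, Hq | lra]. }
  assert (Hw : forall i, 0 <= wterm q i z).
  { intros i. destruct (annulus_factors q Hq z i H1 H2).
    pose proof (qpow_pos q Hq (S i)).
    apply Rdiv_le_0_compat; [apply Rmult_le_pos; lra | lra]. }
  pose (V := fsum (fun i => vterm q i z)). pose (W := fsum (fun i => wterm q i z)).
  pose (V2 := fsum (fun i => vterm q i z ^ 2)). pose (W2 := fsum (fun i => wterm q i z ^ 2)).
  assert (Ed : dlog q (S M) z = V (S M) - W (S M)).
  { unfold dlog, V, W, Rminus.
    rewrite (fsum_ext _ (fun i => vterm q i z + -1 * wterm q i z)) by (intros; ring).
    rewrite fsum_plus, fsum_scal. ring. }
  assert (Ed2 : dlog2 q (S M) z = V (S M) + V2 (S M) + W (S M) + W2 (S M)).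
  { unfold dlog2, V, W, V2, W2. rewrite <- !fsum_plus. apply fsum_ext. intros; ring. }
  (* [wterm (i+1) <= vterm i] since [q^2 z^2 <= 1], so only [wterm 0] is not
     compensated by [V]. *)
  assert (Hvw : forall i, wterm q (S i) z <= vterm q i z).
  { intros i. unfold wterm, vterm.
    destruct (annulus_factors q Hq z i H1 H2) as [Ha _].
    destruct (annulus_factors q Hq z (S i) H1 H2) as [_ Hb].
    apply Rle_div_l; [exact Hb|].
    replace (q ^ i / (z - q ^ i) * (1 - q ^ S (S i) * z)) with
      ((q ^ i * (1 - q ^ S (S i) * z)) / (z - q ^ i)) by (field; lra).
    apply (proj1 (Rle_div_r _ _ _ Ha)).
    pose proof (qpow_pos q Hq i) as Hp. simpl.
    assert (0 < q * z) by nra. assert (q * z * (q * z) <= 1) by nra.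
    nra. }
  assert (HW : W (S M) <= wterm q 0 z + V (S M)).
  { unfold W. rewrite fsum_head.
    pose proof (fsum_le _ _ M Hvw) as H. fold (V M) in H.
    change (V (S M)) with (V M + vterm q M z). specialize (Hv M). lra. }
  assert (HW2 : wterm q 0 z ^ 2 <= W2 (S M)).
  { unfold W2. rewrite fsum_head.
    assert (0 <= fsum (fun i => wterm q (S i) z ^ 2) M)
      by (apply fsum_nonneg; intros; apply pow2_ge_0). lra. }
  assert (HV2 : vterm q 0 z ^ 2 <= V2 (S M)).
  { unfold V2. rewrite fsum_head.
    assert (0 <= fsum (fun i => vterm q (S i) z ^ 2) M)
      by (apply fsum_nonneg; intros; apply pow2_ge_0). lra. }
  assert (HV : vterm q 0 z <= V (S M)).
  { unfold V. rewrite fsum_head.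
    assert (0 <= fsum (fun i => vterm q (S i) z) M)
      by (apply fsum_nonneg; intros; apply Hv). lra. }
  (* From [z < 1/q] comes [1 / (z - 1) >= q / (1 - q)]. *)
  assert (Hgap : 0 < gap <= vterm q 0 z).
  { unfold gap, vterm. simpl. split; [apply Rdiv_lt_0_compat; lra|].
    apply Rle_div_l; [lra|].
    replace (1 / (z - 1) * (1 - q)) with ((1 - q) / (z - 1)) by (field; lra).
    apply Rle_div_r; [lra | nra]. }
  assert (HV2' : gap ^ 2 <= V2 (S M)) by nra.
  rewrite Ed2. rewrite Ed in *. unfold curv. specialize (Hw 0%nat).
  destruct (Rle_lt_dec (V (S M)) (W (S M))) as [Hle|Hlt].
  (* Here the excess [W - V] is at most [wterm 0], whose square is already part of [W2]. In the
     other case [V - W] is positive and at most [slope] by hypothesis. *)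
  - assert ((V (S M) - W (S M)) ^ 2 <= wterm q 0 z ^ 2).
    { replace ((V (S M) - W (S M)) ^ 2) with ((W (S M) - V (S M)) ^ 2) by ring.
      apply pow_incr. lra. }
    pose proof (pow2_ge_0 slope). lra.
  - assert ((V (S M) - W (S M)) ^ 2 <= slope ^ 2) by (apply pow_incr; lra).
    pose proof (pow2_ge_0 (wterm q 0 z)). lra.
Qed.

Lemma theta_coef_pos (j : nat) : 0 < theta_coef q j.
Proof. unfold theta_coef. apply pow_lt. lra. Qed.

Lemma trA_le (M j : nat) : Rabs (trA q M j) <= Rabs (theta_coef q j).
Proof.
  apply Rle_trans with (1 * Rabs (theta_coef q j)); [|lra].
  unfold trA. rewrite Rabs_mult.
  apply Rmult_le_compat_r; [apply Rabs_pos|].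
  destruct (qb_bound q Hq M j). rewrite Rabs_pos_eq; lra.
Qed.

Lemma trB_le (M j : nat) : Rabs (trB q M j) <= Rabs (theta_coef q j).
Proof.
  apply Rle_trans with (1 * Rabs (theta_coef q j)); [|lra].
  unfold trB. rewrite Rabs_mult.
  apply Rmult_le_compat_r; [apply Rabs_pos|].
  destruct (qb_bound q Hq M (S j)). rewrite Rabs_pos_eq; lra.
Qed.

Lemma euler_le (a b : nat -> R) :
  (forall j, Rabs (b j) <= Rabs (a j)) ->
  forall j, Rabs (euler b j) <= Rabs (euler a j).
Proof.
  intros H j. unfold euler. rewrite !Rabs_mult.
  apply Rmult_le_compat_l; [apply Rabs_pos | apply H].
Qed.

Lemma neuler_le (a b : nat -> R) :
  (forall j, Rabs (b j) <= Rabs (a j)) ->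
  forall j, Rabs (neuler b j) <= Rabs (neuler a j).
Proof.
  intros H j. unfold neuler. rewrite !Rabs_Ropp, !Rabs_mult.
  apply Rmult_le_compat_l; [apply Rabs_pos | apply H].
Qed.

Lemma bil_lim (A B : nat -> nat -> R) (a b : nat -> R) (z : R) :
  entire a -> entire b ->
  (forall M j, Rabs (A M j) <= Rabs (a j)) ->
  (forall M j, Rabs (B M j) <= Rabs (b j)) ->
  (forall j, is_lim_seq (fun M => A M j) (a j)) ->
  (forall j, is_lim_seq (fun M => B M j) (b j)) ->
  is_lim_seq (fun M => bil (A M) (B M) z) (bil a b z).
Proof.
  intros Ha Hb HA HB LA LB. apply is_lim_seq_minus'.
  - now apply PSeries_tannery.
  - apply is_lim_seq_mult'; [apply is_lim_seq_const|].
    now apply PSeries_tannery.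
Qed.

Lemma trA_lim (j : nat) : is_lim_seq (fun M => trA q M j) (theta_coef q j).
Proof.
  rewrite <- (Rmult_1_l (theta_coef q j)). unfold trA.
  apply is_lim_seq_mult'; [now apply qb_lim | apply is_lim_seq_const].
Qed.

Lemma trB_lim (j : nat) : is_lim_seq (fun M => trB q M j) (theta_coef q j).
Proof.
  rewrite <- (Rmult_1_l (theta_coef q j)). unfold trB.
  apply is_lim_seq_mult'; [now apply qb_lim | apply is_lim_seq_const].
Qed.

Lemma euler_lim (A : nat -> nat -> R) (a : nat -> R) :
  (forall j, is_lim_seq (fun M => A M j) (a j)) ->
  forall j, is_lim_seq (fun M => euler (A M) j) (euler a j).
Proof.
  intros H j. apply is_lim_seq_mult'; [apply is_lim_seq_const | apply H].
Qed.

Lemma neuler_lim (A : nat -> nat -> R) (a : nat -> R) :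
  (forall j, is_lim_seq (fun M => A M j) (a j)) ->
  forall j, is_lim_seq (fun M => neuler (A M) j) (neuler a j).
Proof.
  intros H j. unfold neuler. apply is_lim_seq_opp with (l := Finite (INR (S j) * a j)).
  apply is_lim_seq_mult'; [apply is_lim_seq_const | apply H].
Qed.

(** Both sides of the product identity are differentiated: the series termwise, the product
    logarithmically. The identity holds on an open set, so the derivatives agree. The constant [g]
    stays anonymous because it cancels in every later use. *)
Lemma triple_product_jets (M : nat) : exists g, 0 < g /\
  (forall z, 0 < z -> bil (trA q M) (trB q M) z = g * triple q M z) /\
  (forall z, 1 < z -> q * z < 1 ->
    bil (euler (trA q M)) (neuler (trB q M)) z = g * triple q M z * dlog q M z /\
    bil (euler (euler (trA q M))) (neuler (neuler (trB q M))) z =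
      g * triple q M z * (dlog q M z ^ 2 - dlog2 q M z)).
Proof.
  pose (g := qfac q M * qfac q M / qfac q (M + M)).
  pose proof (theta_coef_entire q Hq) as Hc.
  assert (HA : entire (trA q M)) by (apply (entire_le (theta_coef q)); [apply trA_le | auto]).
  assert (HB : entire (trB q M)) by (apply (entire_le (theta_coef q)); [apply trB_le | auto]).
  exists g. split.
  { pose proof (qfac_pos q Hq M). pose proof (qfac_pos q Hq (M + M)).
    apply Rdiv_lt_0_compat; [apply Rmult_lt_0_compat|]; auto. }
  assert (E0 : forall z, 0 < z -> bil (trA q M) (trB q M) z = g * triple q M z)
    by (intros; now apply triple_product).
  split; [exact E0|].
  assert (Hloc : forall z, 1 < z -> q * z < 1 -> locally z (fun t => 1 < t /\ q * t < 1)).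
  { intros z H1 H2.
    assert (H3 : z < / q).
    { apply Rmult_lt_reg_l with q; [lra|]. rewrite Rinv_r; lra. }
    apply filter_and.
    - now apply (open_gt 1).
    - apply filter_imp with (fun t => t < / q); [|now apply (open_lt (/ q))].
      intros t Ht. apply Rmult_lt_reg_l with (/ q).
      + apply Rinv_0_lt_compat; lra.
      + rewrite <- Rmult_assoc, Rinv_l; lra. }
  assert (E1 : forall z, 1 < z -> q * z < 1 ->
    bil (euler (trA q M)) (neuler (trB q M)) z = g * triple q M z * dlog q M z).
  { intros z H1 H2.
    pose proof (is_derive_bil _ _ z HA HB ltac:(lra)) as D1.
    pose proof (is_derive_scal _ _ g _ (is_derive_triple q Hq M z H1 H2)) as D2.
    apply is_derive_ext_loc with (g := bil (trA q M) (trB q M)) in D2.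
    2:{ apply filter_imp with (2 := Hloc z H1 H2). intros t [Ht _].
        rewrite E0 by lra. reflexivity. }
    apply is_derive_unique in D1. apply is_derive_unique in D2.
    rewrite D1 in D2. apply (Rmult_eq_reg_r (/ z)).
    - change (bil (euler (trA q M)) (neuler (trB q M)) z / z =
        g * triple q M z * dlog q M z * / z).
      rewrite D2. change (g * (triple q M z * dlog q M z / z) =
        g * triple q M z * dlog q M z * / z). field. lra.
    - apply Rinv_neq_0_compat. lra. }
  intros z H1 H2. split; [now apply E1|].
  pose proof (is_derive_bil _ _ z (entire_euler _ HA) (entire_neuler _ HB) ltac:(lra)) as D1.
  pose proof (is_derive_scal _ _ g _ (is_derive_triple q Hq M z H1 H2)) as D2.
  pose proof (@is_derive_mult R_AbsRing _ _ z _ _ D2 (is_derive_dlog q Hq M z H1 H2)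
     (fun n m => Rmult_comm n m)) as D3.
  apply is_derive_ext_loc with (g := bil (euler (trA q M)) (neuler (trB q M))) in D3.
  2:{ apply filter_imp with (2 := Hloc z H1 H2). intros t [Ht Ht'].
      rewrite E1 by lra. reflexivity. }
  apply is_derive_unique in D1. apply is_derive_unique in D3.
  rewrite D1 in D3. apply (Rmult_eq_reg_r (/ z)).
  - transitivity (bil (euler (euler (trA q M))) (neuler (neuler (trB q M))) z / z);
      [reflexivity|].
    rewrite D3. unfold plus, mult, scal; simpl. unfold mult; simpl. field. lra.
  - apply Rinv_neq_0_compat. lra.
Qed.

(* [THi] is the [i]-th iterate of [z d/dz] on [TH0 z = sum_(j in Z) (-1)^j q^(j (j+1) / 2) z^j]. *)
Definition TH0 : R -> R := bil (theta_coef q) (theta_coef q).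
Definition TH1 : R -> R := bil (euler (theta_coef q)) (neuler (theta_coef q)).
Definition TH2 : R -> R :=
  bil (euler (euler (theta_coef q))) (neuler (neuler (theta_coef q))).

Lemma TH0_lim (z : R) : is_lim_seq (fun M => bil (trA q M) (trB q M) z) (TH0 z).
Proof.
  apply bil_lim; auto using theta_coef_entire, trA_le, trB_le, trA_lim, trB_lim.
Qed.

Lemma TH1_lim (z : R) :
  is_lim_seq (fun M => bil (euler (trA q M)) (neuler (trB q M)) z) (TH1 z).
Proof.
  apply bil_lim; auto using entire_euler, entire_neuler, theta_coef_entire,
    euler_le, neuler_le, trA_le, trB_le, euler_lim, neuler_lim, trA_lim, trB_lim.
Qed.

Lemma TH2_lim (z : R) :
  is_lim_seq (fun M => bil (euler (euler (trA q M))) (neuler (neuler (trB q M))) z)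
    (TH2 z).
Proof.
  apply bil_lim; auto 6 using entire_euler, entire_neuler, theta_coef_entire,
    euler_le, neuler_le, trA_le, trB_le, euler_lim, neuler_lim, trA_lim, trB_lim.
Qed.

(** Only the weak inequality survives the limit. It still decides the parity of [N] at a zero, where
    it is opposed to the strict inequality [theta(-1/y) > 0]. *)
Lemma TH0_nonneg (z : R) : 1 < z -> q * z < 1 -> 0 <= TH0 z.
Proof.
  intros H1 H2.
  refine (is_lim_seq_le (fun _ => 0) _ 0 _ _ (is_lim_seq_const 0) (TH0_lim z)).
  intros M. destruct (triple_product_jets M) as (g & Hg & E0 & _).
  rewrite E0 by lra. pose proof (triple_pos q Hq M z H1 H2).
  apply Rmult_le_pos; lra.
Qed.

(** [TH2 - TH1] is [z^2] times the second derivative of [TH0]. The hypothesis is strict so that it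
    passes to the finite products with large [M]; the weak conclusion then passes back to the
    limit. *)
Lemma TH_concave (z : R) : 1 < z -> q * z < 1 ->
  TH1 z < slope * TH0 z -> TH2 z - TH1 z <= - curv * TH0 z.
Proof.
  intros H1 H2 H.
  assert (L : is_lim_seq (fun M => slope * bil (trA q M) (trB q M) z -
     bil (euler (trA q M)) (neuler (trB q M)) z) (slope * TH0 z - TH1 z)).
  { apply is_lim_seq_minus'; [|apply TH1_lim].
    apply is_lim_seq_mult'; [apply is_lim_seq_const | apply TH0_lim]. }
  apply is_lim_seq_spec in L.
  assert (Hp : 0 < slope * TH0 z - TH1 z) by lra.
  destruct (L (mkposreal _ Hp)) as [M0 HM0]. simpl in HM0.
  refine (is_lim_seq_le_loc
    (fun M => bil (euler (euler (trA q M))) (neuler (neuler (trB q M))) z -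
              bil (euler (trA q M)) (neuler (trB q M)) z)
    (fun M => - curv * bil (trA q M) (trB q M) z) (TH2 z - TH1 z) (- curv * TH0 z) _ _ _).
  - exists (S M0). intros [|M] HM; [lia|]. specialize (HM0 (S M) ltac:(lia)).
    apply Rabs_def2 in HM0. destruct HM0 as [_ HM0].
    destruct (triple_product_jets (S M)) as (g & Hg & E0 & E12).
    destruct (E12 z H1 H2) as [E1 E2]. rewrite E0 in * by lra. rewrite E1 in *. rewrite E2.
    pose proof (Rmult_lt_0_compat _ _ Hg (triple_pos q Hq (S M) z H1 H2)) as HP.
    set (P := g * triple q (S M) z) in *.
    assert (Hd : dlog q (S M) z <= slope).
    { apply Rmult_le_reg_l with P; lra. }
    pose proof (dlog_concave M z H1 H2 Hd). nra.
  - apply is_lim_seq_minus'; [apply TH2_lim | apply TH1_lim].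
  - apply is_lim_seq_mult'; [apply is_lim_seq_const | apply TH0_lim].
Qed.

End Concavity.

(** * Sign of the derivative in q at a zero *)

Section Core.

Variable q : R.
Hypothesis Hq : 0 < q < 1.

Let phi (x : R) : R := PSeries (theta_coef q) x.
Let He : entire (theta_coef q) := theta_coef_entire q Hq.

Lemma theta_functional (x : R) :
  PSeries (theta_coef q) x = 1 + q * x * PSeries (theta_coef q) (q * x).
Proof.
  rewrite PSeries_step by exact He. f_equal.
  rewrite Rmult_comm, (Rmult_comm q), Rmult_assoc, (Rmult_comm x). f_equal.
  unfold PSeries. rewrite <- Series_scal_l. apply Series_ext. intros n.
  rewrite theta_coef_S, Rpow_mult_distr. simpl. ring.
Qed.

(** Consecutive coefficients of theta have ratio [q^(l+1)], so the condition on [p] says exactly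
    that the absolute values of the terms decrease. *)
Lemma theta_alternating (p : nat -> R) (t : R) : 0 <= t ->
  (forall l, 0 <= p l) -> (forall l, p (S l) * (q ^ S l * t) <= p l) ->
  entire (fun l => p l * theta_coef q l) ->
  0 <= PSeries (fun l => p l * theta_coef q l) (- t).
Proof.
  intros Ht Hp Hdec Hent.
  assert (E : forall n, p n * theta_coef q n * (- t) ^ n =
                        (-1) ^ n * (p n * theta_coef q n * t ^ n)).
  { intros n. replace (- t) with (-1 * t) by ring. rewrite Rpow_mult_distr. ring. }
  unfold PSeries. rewrite (Series_ext _ _ E). apply alternating_nonneg.
  - intros n. pose proof (theta_coef_pos q Hq n) as Hc. pose proof (pow_le t n Ht) as Htn.
    pose proof (qpow_pos q Hq (S n)) as Hs.
    rewrite theta_coef_S. split.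
    + apply Rmult_le_pos; [apply Rmult_le_pos|apply pow_le; exact Ht]; [apply Hp|].
      apply Rmult_le_pos; lra.
    + change (t ^ S n) with (t * t ^ n).
      replace (p (S n) * (theta_coef q n * q ^ S n) * (t * t ^ n)) with
        (p (S n) * (q ^ S n * t) * (theta_coef q n * t ^ n)) by ring.
      rewrite (Rmult_assoc (p n)). apply Rmult_le_compat_r; [|apply Hdec].
      apply Rmult_le_pos; lra.
  - apply (ex_series_ext _ _ E). now apply entire_ex_series.
Qed.

Lemma theta_neg_nonneg (t : R) : 0 <= t -> q * t <= 1 -> 0 <= phi (- t).
Proof.
  intros Ht Hqt. unfold phi.
  rewrite (PSeries_ext _ (fun l => 1 * theta_coef q l)) by (intros; ring).
  apply theta_alternating; [exact Ht | intros; lra | |].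
  - intros l. pose proof (qpow_le_1 q Hq l). pose proof (qpow_pos q Hq l). simpl. nra.
  - now apply entire_scal.
Qed.

(** The functional equation [theta(-t) = 1 - q t theta(-q t)] sharpens the weak bound: with
    [s = q t], it gives in turn [theta(-q^2 s) <= 1], [theta(-q s) > 0], [theta(-s) < 1] and
    [theta(-t) > 0]. *)
Lemma theta_neg_pos (t : R) : 0 < t -> q * t <= 1 -> 0 < phi (- t).
Proof.
  intros Ht Hqt. unfold phi.
  pose (s := q * t). assert (Hs : 0 < s <= 1).
  { unfold s. split; [apply Rmult_lt_0_compat; lra | exact Hqt]. }
  assert (Hs1 : 0 < q * s < 1) by nra.
  assert (Hs2 : 0 < q * (q * s) < 1) by nra.
  assert (Hs3 : 0 < q * (q * (q * s)) < 1) by nra.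
  assert (H3 : PSeries (theta_coef q) (- (q * (q * s))) <= 1).
  { rewrite theta_functional.
    replace (q * - (q * (q * s))) with (- (q * (q * (q * s)))) by ring.
    assert (0 <= phi (- (q * (q * (q * s))))) by (apply theta_neg_nonneg; nra).
    unfold phi in *. nra. }
  assert (H2 : 0 < PSeries (theta_coef q) (- (q * s))).
  { rewrite theta_functional. replace (q * - (q * s)) with (- (q * (q * s))) by ring.
    nra. }
  assert (H1 : PSeries (theta_coef q) (- s) < 1).
  { rewrite theta_functional. replace (q * - s) with (- (q * s)) by ring. nra. }
  rewrite theta_functional. replace (q * - t) with (- s) by (unfold s; ring). nra.
Qed.

Lemma TH0_step (y : R) : 0 < y -> TH0 q y = - (q * y) * TH0 q (q * y).
Proof.
  intros Hy. unfold TH0, bil.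
  rewrite (theta_functional (- y)), (theta_functional (- / (q * y))).
  replace (q * - / (q * y)) with (- / y) by (field; lra).
  replace (q * - y) with (- (q * y)) by ring. field. lra.
Qed.

Lemma TH0_shift (N : nat) (y : R) : 0 < y ->
  TH0 q y = (-1) ^ N * theta_coef q N * y ^ N * TH0 q (q ^ N * y).
Proof.
  intros Hy. induction N as [|N IH].
  - change (theta_coef q 0) with 1. replace (q ^ 0 * y) with y by (simpl; ring).
    simpl. ring.
  - rewrite IH, TH0_step.
    + replace (q ^ S N * y) with (q * (q ^ N * y)) by (simpl; ring).
      rewrite theta_coef_S. simpl. ring.
    + apply Rmult_lt_0_compat; [now apply qpow_pos | exact Hy].
Qed.

Lemma is_derive_shift (N : nat) (s k : R) (F F1 : R -> R) :
  0 < s -> (forall z, 0 < z -> is_derive F z (F1 z / z)) ->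
  forall y, 0 < y -> is_derive (fun y => k * (y ^ N * F (s * y))) y
    (k * (y ^ N * (INR N * F (s * y) + F1 (s * y))) / y).
Proof.
  intros Hs HF y Hy.
  assert (Hsy : 0 < s * y) by now apply Rmult_lt_0_compat.
  pose proof (HF _ Hsy) as D.
  auto_derive; [eexists; exact D|].
  rewrite (is_derive_unique (fun x : R => F x) _ _ D).
  destruct N as [|N]; simpl pred.
  - simpl. field. lra.
  - rewrite <- tech_pow_Rmult. field. lra.
Qed.

Lemma is_derive_TH0 (z : R) : 0 < z -> is_derive (TH0 q) z (TH1 q z / z).
Proof. intros Hz. apply is_derive_bil; auto. lra. Qed.

Lemma is_derive_TH1 (z : R) : 0 < z -> is_derive (TH1 q) z (TH2 q z / z).
Proof.
  intros Hz. apply is_derive_bil; [| | lra].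
  - now apply entire_euler.
  - now apply entire_neuler.
Qed.

(** Applies [z d/dz] to an identity; the shift laws of [TH1] and [TH2] follow in this way from that
    of [TH0]. *)
Lemma euler_unique (F G F1 G1 : R -> R) :
  (forall z, 0 < z -> is_derive F z (F1 z / z)) ->
  (forall z, 0 < z -> is_derive G z (G1 z / z)) ->
  (forall z, 0 < z -> F z = G z) -> forall z, 0 < z -> F1 z = G1 z.
Proof.
  intros HF HG E z Hz.
  assert (D : is_derive F z (G1 z / z)).
  { apply is_derive_ext_loc with (2 := HG z Hz).
    apply filter_imp with (fun t => 0 < t); [|now apply (open_gt 0)].
    intros t Ht. symmetry. now apply E. }
  apply is_derive_unique in D. rewrite (is_derive_unique _ _ _ (HF z Hz)) in D.
  apply (Rmult_eq_reg_r (/ z)); [exact D | apply Rinv_neq_0_compat; lra].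
Qed.

Lemma TH1_shift (N : nat) (y : R) : 0 < y ->
  TH1 q y = (-1) ^ N * theta_coef q N *
    (y ^ N * (INR N * TH0 q (q ^ N * y) + TH1 q (q ^ N * y))).
Proof.
  revert y. apply (euler_unique (TH0 q) (fun y => (-1) ^ N * theta_coef q N *
    (y ^ N * TH0 q (q ^ N * y)))).
  - apply is_derive_TH0.
  - apply is_derive_shift; [now apply qpow_pos | apply is_derive_TH0].
  - intros z Hz. rewrite (TH0_shift N) by exact Hz. ring.
Qed.

Lemma TH2_shift (N : nat) (y : R) : 0 < y ->
  TH2 q y = (-1) ^ N * theta_coef q N * (y ^ N * (INR N * (INR N * TH0 q (q ^ N * y) +
    TH1 q (q ^ N * y)) + (INR N * TH1 q (q ^ N * y) + TH2 q (q ^ N * y)))).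
Proof.
  revert y. apply (euler_unique (TH1 q) (fun y => (-1) ^ N * theta_coef q N *
    (y ^ N * (INR N * TH0 q (q ^ N * y) + TH1 q (q ^ N * y))))).
  - apply is_derive_TH1.
  - apply (is_derive_shift N (q ^ N) _ (fun z => INR N * TH0 q z + TH1 q z)
      (fun z => INR N * TH1 q z + TH2 q z)); [now apply qpow_pos|].
    intros z Hz.
    pose proof (@is_derive_plus R_AbsRing R_NormedModule _ _ z _ _
      (is_derive_scal _ _ (INR N) _ (is_derive_TH0 z Hz)) (is_derive_TH1 z Hz)) as D.
    replace ((INR N * TH1 q z + TH2 q z) / z) with
      (INR N * (TH1 q z / z) + TH2 q z / z) by (field; lra).
    exact D.
  - intros z Hz. apply TH1_shift. exact Hz.
Qed.

(** [N] is the last exponent with [q^N y >= 1]. The value 1 is still allowed here; at a zero of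
    theta it is excluded afterwards, because [TH0] vanishes at 1. *)
Lemma annulus_index (y : R) : 1 < q * y ->
  exists N, (1 <= N)%nat /\ 1 <= q ^ N * y /\ q * (q ^ N * y) < 1.
Proof.
  intros Hy.
  assert (Hy0 : 0 < y) by nra.
  assert (Hex : exists n, q ^ n * y < 1).
  { destruct (pow_lt_1_zero q) with (/ y) as [n Hn].
    - rewrite Rabs_pos_eq; lra.
    - apply Rinv_0_lt_compat; lra.
    - exists n. specialize (Hn n (le_n n)).
      rewrite Rabs_pos_eq in Hn by (apply Rlt_le, qpow_pos, Hq).
      apply Rmult_lt_compat_r with (r := y) in Hn; [|exact Hy0].
      rewrite Rinv_l in Hn; lra. }
  destruct Hex as [n Hn]. induction n as [|n IH]; [simpl in Hn; nra|].
  destruct (Rlt_le_dec (q ^ n * y) 1) as [H|H]; [now apply IH|].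
  exists n. split; [|split; [exact H | simpl in Hn; lra]].
  destruct n; [simpl in Hn; lra | lia].
Qed.

Lemma qpow_mult_le (l : nat) (t : R) : 0 < t < q -> q ^ S l * t <= q ^ 2.
Proof.
  intros Ht. pose proof (qpow_le_1 q Hq l).
  assert (q ^ l * t <= 1 * t) by (apply Rmult_le_compat_r; lra).
  replace (q ^ S l * t) with (q * (q ^ l * t)) by (simpl; ring).
  replace (q ^ 2) with (q * q) by ring. apply Rmult_le_compat_l; lra.
Qed.

(** Used at [t = 1/y] to turn [D theta > 0] into [TH1 < slope * TH0]. The terms decrease when
    [(m + 1) q^2 <= m], that is when [slope <= m]: this is the origin of [slope]. *)
Lemma principal_part_slope (N : nat) (t : R) : (1 <= N)%nat -> 0 < t < q ->
  PSeries (neuler (theta_coef q)) (- t) <= (slope q + INR N) * phi (- t).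
Proof.
  intros HN Ht.
  enough (H : 0 <= (slope q + INR N) * phi (- t) +
                   -1 * PSeries (neuler (theta_coef q)) (- t)) by lra.
  unfold phi. rewrite <- PSeries_lin by (auto; now apply entire_neuler).
  assert (E : forall l, (slope q + INR N) * theta_coef q l + -1 * neuler (theta_coef q) l =
    (slope q + INR N + INR (S l)) * theta_coef q l) by (intros; unfold neuler; ring).
  rewrite (PSeries_ext _ _ _ E).
  assert (Hq2 : 0 < 1 - q ^ 2) by (simpl; nra).
  assert (Hs : 0 < slope q)
    by (apply Rdiv_lt_0_compat; [apply pow_lt; lra | exact Hq2]).
  assert (Hs' : slope q * (1 - q ^ 2) = q ^ 2) by (unfold slope; field; lra).
  assert (HN1 : 1 <= INR N) by (apply (le_INR 1); exact HN).
  apply theta_alternating; [lra| | |].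
  - intros l. pose proof (pos_INR (S l)). lra.
  - intros l. rewrite (S_INR (S l)). pose proof (pos_INR (S l)).
    set (m := slope q + INR N + INR (S l)).
    replace (slope q + INR N + (INR (S l) + 1)) with (m + 1) by (unfold m; ring).
    assert (Hm : slope q <= m) by (unfold m; lra).
    pose proof (qpow_mult_le l t Ht) as Hqt.
    assert ((m + 1) * q ^ 2 <= m) by nra.
    apply Rle_trans with ((m + 1) * q ^ 2); [|assumption].
    apply Rmult_le_compat_l; lra.
  - eapply entire_ext; [exact E|].
    apply entire_plus; apply entire_scal; [exact He | now apply entire_neuler].
Qed.

(** Since [gap >= 2 slope], [curv] is at least [4 slope + 3 slope^2]. For [slope <= 1] the term
    [(m - 1) m] alone dominates; otherwise the maximum over [m] of [2 m slope - (m - 1) m], which is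
    [(slope + 1/2)^2], is below [curv]. *)
Lemma curv_bound (m : R) : 3 <= m -> 2 * m * slope q <= (m - 1) * m + curv q.
Proof.
  intros Hm.
  assert (Hq2 : 0 < 1 - q ^ 2) by (simpl; nra).
  assert (Ha : 0 < gap q) by (apply Rdiv_lt_0_compat; lra).
  assert (Hs : 0 < slope q)
    by (apply Rdiv_lt_0_compat; [apply pow_lt; lra | exact Hq2]).
  assert (Hsa : 2 * slope q <= gap q).
  { assert (E : slope q = gap q * (q / (1 + q))) by (unfold slope, gap; field; split; lra).
    assert (q / (1 + q) <= 1 / 2) by (apply Rle_div_l; lra). rewrite E. nra. }
  unfold curv. destruct (Rle_lt_dec (slope q) 1) as [H|H].
  - nra.
  - assert (0 <= (m - 1 / 2 - slope q) ^ 2) by apply pow2_ge_0. nra.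
Qed.

(** This combination is what remains of D^2 theta + D theta in [theta_zero_descending] once [TH1]
    and [TH2] are eliminated. Its coefficients factor as [(m - 1) m + curv] with [m = l + N + 2],
    and passing to [l + 1] adds [2 m]. The terms thus decrease if [2 m slope <= (m - 1) m + curv],
    which is [curv_bound]; [N >= 1] provides [m >= 3]. *)
Lemma principal_part_curv (N : nat) (t : R) : (1 <= N)%nat -> 0 < t < q ->
  0 <= PSeries (neuler (neuler (theta_coef q))) (- t) -
       (2 * INR N + 1) * PSeries (neuler (theta_coef q)) (- t) +
       (INR N ^ 2 + INR N + curv q) * phi (- t).
Proof.
  intros HN Ht.
  assert (He1 := entire_neuler _ He). assert (He2 := entire_neuler _ He1).
  replace (PSeries (neuler (neuler (theta_coef q))) (- t) -
       (2 * INR N + 1) * PSeries (neuler (theta_coef q)) (- t) +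
       (INR N ^ 2 + INR N + curv q) * phi (- t)) with
    (1 * (1 * PSeries (neuler (neuler (theta_coef q))) (- t) +
       - (2 * INR N + 1) * PSeries (neuler (theta_coef q)) (- t)) +
       (INR N ^ 2 + INR N + curv q) * phi (- t)) by ring.
  unfold phi. rewrite <- (PSeries_lin (neuler (neuler (theta_coef q)))) by assumption.
  rewrite <- PSeries_lin by (try assumption; now apply entire_plus; apply entire_scal).
  pose (m := fun l => INR (S l) + INR N + 1).
  assert (E : forall l, 1 * (1 * neuler (neuler (theta_coef q)) l +
      - (2 * INR N + 1) * neuler (theta_coef q) l) +
      (INR N ^ 2 + INR N + curv q) * theta_coef q l =
    ((m l - 1) * m l + curv q) * theta_coef q l)
    by (intros; unfold m, neuler; ring).
  rewrite (PSeries_ext _ _ _ E).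
  assert (Hq2 : 0 < 1 - q ^ 2) by (simpl; nra).
  assert (Hs : 0 < slope q)
    by (apply Rdiv_lt_0_compat; [apply pow_lt; lra | exact Hq2]).
  assert (Hs' : slope q * (1 - q ^ 2) = q ^ 2) by (unfold slope; field; lra).
  assert (HN1 : 1 <= INR N) by (apply (le_INR 1); exact HN).
  assert (Hm : forall l, 3 <= m l).
  { intros l. unfold m. rewrite S_INR. pose proof (pos_INR l). lra. }
  assert (Hpos : forall l, 0 <= (m l - 1) * m l + curv q).
  { intros l. pose proof (curv_bound (m l) (Hm l)). specialize (Hm l). nra. }
  apply theta_alternating; [lra | exact Hpos | |].
  - intros l.
    replace (m (S l)) with (m l + 1) by (unfold m; rewrite !S_INR; ring).
    pose proof (curv_bound (m l) (Hm l)) as Hb. specialize (Hm l).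
    specialize (Hpos l).
    replace ((m l + 1 - 1) * (m l + 1) + curv q) with
      ((m l - 1) * m l + curv q + 2 * m l) by ring.
    set (p := (m l - 1) * m l + curv q) in *.
    pose proof (qpow_mult_le l t Ht) as Hqt.
    apply Rle_trans with ((p + 2 * m l) * q ^ 2);
      [apply Rmult_le_compat_l; lra|].
    assert (Hp : 2 * m l * slope q * (1 - q ^ 2) <= p * (1 - q ^ 2))
      by (apply Rmult_le_compat_r; lra).
    rewrite (Rmult_assoc (2 * m l)), Hs' in Hp. lra.
  - eapply entire_ext; [exact E|].
    apply entire_plus; apply entire_scal; [|exact He].
    now apply entire_plus; apply entire_scal.
Qed.

(* [2 q d/dq = (x d/dx)^2 + x d/dx] on theta. *)
Lemma theta_zero_descending (x : R) : x < 0 -> phi x = 0 ->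
  0 < PSeries (euler (theta_coef q)) x ->
  0 < PSeries (euler (euler (theta_coef q))) x + PSeries (euler (theta_coef q)) x.
Proof.
  intros Hx H0 H1.
  pose (y := - x). assert (Hy : 0 < y) by (unfold y; lra).
  assert (Exy : x = - y) by (unfold y; ring). rewrite Exy in *. clear Exy.
  clearbody y. clear Hx x.
  assert (Hqy : 1 < q * y).
  { destruct (Rlt_le_dec 1 (q * y)) as [H|H]; [exact H|].
    pose proof (theta_neg_pos y Hy H). lra. }
  destruct (annulus_index y Hqy) as (N & HN & Hz1 & Hz2).
  set (z := q ^ N * y) in *.
  pose proof (TH0_shift N y Hy) as S0. pose proof (TH1_shift N y Hy) as S1.
  pose proof (TH2_shift N y Hy) as S2. fold z in S0, S1, S2.
  assert (Ht : 0 < / y < q).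
  { split; [now apply Rinv_0_lt_compat|].
    apply Rmult_lt_reg_r with y; [exact Hy|]. rewrite Rinv_l; lra. }
  assert (Hh : 0 < phi (- / y)) by (apply theta_neg_pos; nra).
  pose proof (principal_part_slope N _ HN Ht) as A.
  pose proof (principal_part_curv N _ HN Ht) as B.
  unfold TH0 at 1, bil in S0. unfold TH1 at 1, bil in S1. unfold TH2 at 1, bil in S2.
  unfold phi in *.
  set (p0 := PSeries (theta_coef q) (- y)) in *.
  set (p1 := PSeries (euler (theta_coef q)) (- y)) in *.
  set (p2 := PSeries (euler (euler (theta_coef q))) (- y)) in *.
  set (h0 := PSeries (theta_coef q) (- / y)) in *.
  set (h1 := PSeries (neuler (theta_coef q)) (- / y)) in *.
  set (h2 := PSeries (neuler (neuler (theta_coef q))) (- / y)) in *.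
  assert (Hk : 0 < theta_coef q N * y ^ N)
    by (apply Rmult_lt_0_compat; [now apply theta_coef_pos | now apply pow_lt]).
  (* At [z = 1] the two halves of [TH0] cancel, but the zero of theta leaves [TH0 y = - h0 / y],
     which is not 0. *)
  assert (Hz : 1 < z).
  { destruct Hz1 as [H|H]; [exact H|]. exfalso. rewrite <- H in S0.
    unfold TH0, bil in S0. rewrite Rinv_1 in S0. nra. }
  pose proof (TH0_nonneg q Hq z Hz Hz2) as T0.
  pose proof (TH_concave q Hq z Hz Hz2) as T.
  set (k := theta_coef q N * y ^ N) in *.
  (* [S0] now reads [- h0 / y = (-1)^N k TH0(z)] with [h0] and [k] positive and [TH0(z)]
     nonnegative. *)
  assert (Hsgn : (-1) ^ N = -1).
  { destruct (Nat.Even_or_Odd N) as [[m Hm]|[m Hm]]; subst N.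
    - exfalso. rewrite pow_1_even in S0.
      assert (0 <= k * TH0 q z) by (apply Rmult_le_pos; lra).
      unfold k in *. nra.
    - rewrite Nat.add_1_r. apply pow_1_odd. }
  rewrite Hsgn in S0, S1, S2.
  set (T0z := TH0 q z) in *. set (T1z := TH1 q z) in *. set (T2z := TH2 q z) in *.
  assert (S0' : / y * h0 = k * T0z) by (unfold k; lra).
  assert (S1' : p1 = / y * h1 - k * (INR N * T0z + T1z)) by (unfold k; lra).
  assert (S2' : p2 = / y * h2 - k * (INR N * (INR N * T0z + T1z) + (INR N * T1z + T2z)))
    by (unfold k; lra).
  clear S0 S1 S2.
  assert (A' : / y * h1 <= (slope q + INR N) * (k * T0z)).
  { rewrite <- S0'. apply Rmult_le_compat_l with (r := / y) in A; lra. }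
  assert (B' : 0 <= / y * h2 - (2 * INR N + 1) * (/ y * h1) +
                 (INR N ^ 2 + INR N + curv q) * (k * T0z)).
  { rewrite <- S0'. apply Rmult_le_compat_l with (r := / y) in B; lra. }
  (* [p1 > 0] bounds [k (N T0z + T1z)] by [h1 / y], hence by [(slope + N) k T0z] through [A']. *)
  assert (HT : k * T1z < k * (slope q * T0z)) by nra.
  apply Rmult_lt_reg_l in HT; [|exact Hk].
  specialize (T HT).
  apply Rmult_le_compat_l with (r := k) in T; [|lra].
  (* In [p2 + p1] the part [T2z + (2N+1) T1z] is split as [(T2z - T1z) + (2N+2) T1z]. Concavity
     bounds the first summand, [p1 > 0] the second, and the remainder is the right side of [B']. *)
  rewrite S2'. pose proof (pos_INR N). nra.
Qed.

End Core.

(** * Dependence on both variables *)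

(** The weights are the exponents of [q] in theta, so [tri] applied to [theta_coef q] gives the
    coefficients of [q d theta/dq]; [tri_alt] is the heat equation, coefficient by coefficient. *)
Definition tri (a : nat -> R) (j : nat) : R := INR (j * (j + 1) / 2) * a j.

Lemma tri_alt (a : nat -> R) (j : nat) :
  tri a j = / 2 * euler (euler a) j + / 2 * euler a j.
Proof.
  unfold tri, euler.
  assert (H : INR (j * (j + 1)) = 2 * INR (j * (j + 1) / 2)).
  { rewrite <- (mult_INR 2). f_equal. symmetry.
    induction j as [|j IH]; [reflexivity|].
    replace (S j * (S j + 1))%nat with (j * (j + 1) + S j * 2)%nat by ring.
    rewrite Nat.div_add by easy. lia. }
  rewrite mult_INR, plus_INR in H. simpl (INR 1) in H.
  replace (INR (j * (j + 1) / 2)) with (/ 2 * (INR j * (INR j + 1))) by lra. ring.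
Qed.

Lemma entire_tri (a : nat -> R) : entire a -> entire (tri a).
Proof.
  intros Ha. eapply entire_ext; [intros j; symmetry; apply tri_alt|].
  apply entire_plus; apply entire_scal; auto using entire_euler.
Qed.

Lemma entire_derive (a : nat -> R) : entire a -> entire (PS_derive a).
Proof.
  intros Ha. apply entire_CV_radius. rewrite CV_radius_derive.
  now apply entire_CV_radius.
Qed.

Lemma Series_Rabs_le (u v : nat -> R) :
  (forall n, Rabs (u n) <= v n) -> ex_series v ->
  ex_series u /\ Rabs (Series u) <= Series v.
Proof.
  intros H Hv.
  assert (Hu : ex_series (fun n => Rabs (u n))).
  { apply (@ex_series_le R_AbsRing R_CompleteNormedModule) with (2 := Hv).
    intros n. change (Rabs (Rabs (u n)) <= v n). now rewrite Rabs_Rabsolu. }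
  split; [now apply ex_series_Rabs|].
  eapply Rle_trans; [now apply Series_Rabs|].
  apply Series_le; [|exact Hv]. intros n. split; [apply Rabs_pos | apply H].
Qed.

Lemma pow_lipschitz (Q a b : R) (m : nat) : 0 < Q -> 0 <= a <= Q -> 0 <= b <= Q ->
  Rabs (a ^ m - b ^ m) <= INR m * Q ^ m * (Rabs (a - b) / Q).
Proof.
  intros HQ Ha Hb. induction m as [|m IH].
  - simpl. rewrite Rminus_diag, Rabs_R0. lra.
  - replace (a ^ S m - b ^ S m) with (a * (a ^ m - b ^ m) + b ^ m * (a - b))
      by (simpl; ring).
    eapply Rle_trans; [apply Rabs_triang|]. rewrite !Rabs_mult.
    rewrite (Rabs_pos_eq a), (Rabs_pos_eq (b ^ m)) by (try apply pow_le; lra).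
    assert (H1 : a * Rabs (a ^ m - b ^ m) <= Q * (INR m * Q ^ m * (Rabs (a - b) / Q))).
    { apply Rmult_le_compat; try lra. apply Rabs_pos. }
    assert (H2 : b ^ m * Rabs (a - b) <= Q ^ m * Rabs (a - b)).
    { apply Rmult_le_compat_r; [apply Rabs_pos | now apply pow_incr]. }
    rewrite S_INR. simpl (Q ^ S m).
    replace ((INR m + 1) * (Q * Q ^ m) * (Rabs (a - b) / Q)) with
      (Q * (INR m * Q ^ m * (Rabs (a - b) / Q)) + Q ^ m * Rabs (a - b)) by (field; lra).
    lra.
Qed.

(** The remainder is measured by the relative increment [(b - a) / a], so that for [m] the exponent
    of [theta_coef] the bound contains the coefficient of [tri (tri (theta_coef Q))]: one convergent
    series then serves for all [b <= Q]. *)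
Lemma pow_taylor (Q a b : R) (m : nat) : 0 < a -> a <= b <= Q ->
  Rabs (b ^ m - a ^ m - INR m * a ^ m * ((b - a) / a)) <=
  INR m * INR m * Q ^ m * ((b - a) / a) ^ 2.
Proof.
  intros Ha Hb. induction m as [|m IH].
  - simpl. replace (1 - 1 - 0 * 1 * ((b - a) / a)) with 0 by ring.
    rewrite Rabs_R0. lra.
  - set (d := (b - a) / a) in *.
    assert (Hd : b = a + a * d) by (unfold d; field; lra).
    assert (Hd0 : 0 <= d) by (apply Rdiv_le_0_compat; lra).
    replace (b ^ S m - a ^ S m - INR (S m) * a ^ S m * d) with
      (b * (b ^ m - a ^ m - INR m * a ^ m * d) + INR m * (a * a ^ m) * d ^ 2)
      by (rewrite S_INR; simpl; clearbody d; rewrite Hd; ring).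
    eapply Rle_trans; [apply Rabs_triang|]. rewrite Rabs_mult.
    pose proof (pos_INR m) as Hm.
    assert (Ham : 0 < a ^ m <= Q ^ m)
      by (split; [apply pow_lt; lra | apply pow_incr; lra]).
    assert (Hm2 : 0 <= INR m * d ^ 2) by (apply Rmult_le_pos; [lra | apply pow2_ge_0]).
    rewrite (Rabs_pos_eq b) by lra.
    rewrite (Rabs_pos_eq (INR m * (a * a ^ m) * d ^ 2)).
    2:{ replace (INR m * (a * a ^ m) * d ^ 2) with (INR m * d ^ 2 * (a * a ^ m)) by ring.
        apply Rmult_le_pos; [exact Hm2 | apply Rmult_le_pos; lra]. }
    assert (H1 : b * Rabs (b ^ m - a ^ m - INR m * a ^ m * d) <=
                 Q * (INR m * INR m * Q ^ m * d ^ 2)).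
    { apply Rmult_le_compat; try lra. apply Rabs_pos. }
    assert (H2 : INR m * d ^ 2 * (a * a ^ m) <= INR m * d ^ 2 * (Q * Q ^ m)).
    { apply Rmult_le_compat_l; [exact Hm2|]. apply Rmult_le_compat; lra. }
    assert (H3 : 0 <= (INR m + 1) * (Q * Q ^ m * d ^ 2)).
    { apply Rmult_le_pos; [lra|]. apply Rmult_le_pos; [nra | apply pow2_ge_0]. }
    rewrite S_INR. simpl (Q ^ S m).
    replace ((INR m + 1) * (INR m + 1) * (Q * Q ^ m) * d ^ 2) with
      (Q * (INR m * INR m * Q ^ m * d ^ 2) + INR m * d ^ 2 * (Q * Q ^ m) +
       (INR m + 1) * (Q * Q ^ m * d ^ 2)) by ring.
    lra.
Qed.

Section TwoVariables.

Variable q0 : R.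
Hypothesis Hq0 : 0 < q0 < 1.

Let Q : R := (1 + q0) / 2.

Lemma theta_increasing_in_q (x : R) :
  0 < PSeries (euler (euler (theta_coef q0))) x + PSeries (euler (theta_coef q0)) x ->
  exists d, 0 < d /\ forall q, q0 < q < q0 + d -> q < 1 ->
    PSeries (theta_coef q0) x < PSeries (theta_coef q) x.
Proof.
  intros HS.
  assert (HQ : 0 < Q < 1) by (unfold Q; lra).
  assert (He := theta_coef_entire q0 Hq0).
  assert (HS' : 0 < PSeries (tri (theta_coef q0)) x).
  { rewrite (PSeries_ext _ _ _ (tri_alt (theta_coef q0))).
    rewrite PSeries_lin by auto using entire_euler. lra. }
  set (s := PSeries (tri (theta_coef q0)) x) in *.
  pose (C := Series (fun j => Rabs (tri (tri (theta_coef Q)) j * x ^ j))).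
  assert (HeQ : entire (tri (tri (theta_coef Q))))
    by auto using entire_tri, theta_coef_entire.
  assert (HC : 0 <= C) by (apply Series_nonneg; [intros; apply Rabs_pos | apply HeQ]).
  (* The second bound makes the relative increment [d] satisfy [d (C + 1) < s], so the linear gain
     [d s] exceeds the error [d^2 C]. The [+ 1] keeps the quotient defined when [C = 0]. *)
  exists (Rmin (Q - q0) (q0 * (s / (C + 1)))). split.
  { apply Rmin_glb_lt; [unfold Q; lra|].
    apply Rmult_lt_0_compat; [lra | apply Rdiv_lt_0_compat; lra]. }
  intros q Hq Hq1.
  assert (HqQ : q < Q) by (pose proof (Rmin_l (Q - q0) (q0 * (s / (C + 1)))); lra).
  assert (Hqs : q - q0 < q0 * (s / (C + 1)))
    by (pose proof (Rmin_r (Q - q0) (q0 * (s / (C + 1)))); lra).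
  set (d := (q - q0) / q0).
  assert (Hd : 0 < d) by (apply Rdiv_lt_0_compat; lra).
  assert (Hds : d * (C + 1) < s).
  { apply Rlt_div_r; [lra|]. apply Rlt_div_l; lra. }
  pose (u := fun j => (theta_coef q j - theta_coef q0 j - tri (theta_coef q0) j * d) * x ^ j).
  assert (Hu : forall j, Rabs (u j) <= d ^ 2 * Rabs (tri (tri (theta_coef Q)) j * x ^ j)).
  { intros j. unfold u. rewrite !Rabs_mult, <- Rmult_assoc.
    apply Rmult_le_compat_r; [apply Rabs_pos|].
    pose proof (pow_taylor Q q0 q (j * (j + 1) / 2) ltac:(lra) ltac:(lra)) as H.
    fold d in H. unfold tri, theta_coef.
    rewrite (Rabs_pos_eq (INR _ * _)).
    - rewrite (Rmult_comm (d ^ 2)), <- (Rmult_assoc (INR _) (INR _)). exact H.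
    - apply Rmult_le_pos; [apply pos_INR|]. apply Rmult_le_pos; [apply pos_INR|].
      apply pow_le. lra. }
  destruct (Series_Rabs_le u _ Hu) as [_ Hsum].
  { apply (@ex_series_scal R_AbsRing R_NormedModule). apply HeQ. }
  rewrite Series_scal_l in Hsum. fold C in Hsum.
  assert (Eu : Series u = 1 * (1 * PSeries (theta_coef q) x + -1 * PSeries (theta_coef q0) x)
                 + - d * s).
  { assert (Hq' := theta_coef_entire q ltac:(lra)). unfold s.
    rewrite <- !PSeries_lin; auto using entire_tri, entire_plus, entire_scal.
    apply Series_ext. intros j. unfold u. ring. }
  rewrite Eu in Hsum. apply Rabs_le_between in Hsum.
  assert (d * (d * (C + 1)) < d * s) by now apply Rmult_lt_compat_l.
  simpl in Hsum. nra.
Qed.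

(** The increment is split at [(q0, x)]. The change in [x] is continuity of one power series; the
    change in [q] is bounded uniformly for [Rabs x <= X] by a series in the larger base [Q]. *)
Lemma theta_derive_continuous (x0 eps : R) : 0 < eps ->
  exists d, 0 < d /\ forall q x, Rabs (q - q0) < d -> Rabs (x - x0) < d ->
    Rabs (PSeries (PS_derive (theta_coef q)) x -
          PSeries (PS_derive (theta_coef q0)) x0) < eps.
Proof.
  intros Heps.
  assert (HQ : 0 < Q < 1) by (unfold Q; lra).
  assert (He := theta_coef_entire q0 Hq0).
  assert (HeQ : entire (PS_derive (tri (theta_coef Q))))
    by auto using entire_derive, entire_tri, theta_coef_entire.
  pose (X := Rabs x0 + 1). assert (HX : 0 < X) by (unfold X; pose proof (Rabs_pos x0); lra).
  pose (C := Series (fun j => Rabs (PS_derive (tri (theta_coef Q)) j * X ^ j))).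
  assert (HC : 0 <= C) by (apply Series_nonneg; [intros; apply Rabs_pos | apply HeQ]).
  assert (Hcont : continuous (PSeries (PS_derive (theta_coef q0))) x0).
  { apply (@ex_derive_continuous R_AbsRing R_NormedModule).
    eexists. apply is_derive_entire. now apply entire_derive. }
  assert (He2 : 0 < eps / 2) by lra.
  destruct (Hcont _ (locally_ball _ (mkposreal _ He2))) as [d1 Hd1].
  assert (Hmin : 0 < Rmin q0 (Q - q0)) by (apply Rmin_glb_lt; unfold Q; lra).
  assert (Hk : 0 < eps / 2 * Q / (C + 1)).
  { apply Rdiv_lt_0_compat; [apply Rmult_lt_0_compat|]; lra. }
  exists (Rmin (Rmin 1 d1) (Rmin (Rmin q0 (Q - q0)) (eps / 2 * Q / (C + 1)))). split.
  { repeat apply Rmin_glb_lt; try lra; try (unfold Q; lra). apply cond_pos. }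
  intros q x Hq Hx.
  pose proof (Rmin_l (Rmin 1 d1) (Rmin (Rmin q0 (Q - q0)) (eps / 2 * Q / (C + 1)))) as M1.
  pose proof (Rmin_r (Rmin 1 d1) (Rmin (Rmin q0 (Q - q0)) (eps / 2 * Q / (C + 1)))) as M2.
  pose proof (Rmin_l 1 d1). pose proof (Rmin_r 1 d1).
  pose proof (Rmin_l (Rmin q0 (Q - q0)) (eps / 2 * Q / (C + 1))).
  pose proof (Rmin_r (Rmin q0 (Q - q0)) (eps / 2 * Q / (C + 1))).
  pose proof (Rmin_l q0 (Q - q0)). pose proof (Rmin_r q0 (Q - q0)).
  assert (Hqr : 0 < q <= Q).
  { assert (Rabs (q - q0) < q0) as A1 by lra. assert (Rabs (q - q0) < Q - q0) as A2 by lra.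
    apply Rabs_def2 in A1. apply Rabs_def2 in A2. lra. }
  assert (HxX : Rabs x <= X).
  { unfold X. pose proof (Rabs_triang (x - x0) x0) as T.
    replace (x - x0 + x0) with x in T by ring. lra. }
  assert (D1 : Rabs (PSeries (PS_derive (theta_coef q0)) x -
                     PSeries (PS_derive (theta_coef q0)) x0) < eps / 2).
  { apply (Hd1 x). change (Rabs (x - x0) < d1). lra. }
  pose (k := Rabs (q - q0) / Q).
  pose (u := fun j => (1 * PS_derive (theta_coef q) j + -1 * PS_derive (theta_coef q0) j) * x ^ j).
  assert (Hk0 : 0 <= k) by (apply Rdiv_le_0_compat; [apply Rabs_pos | lra]).
  assert (Hu : forall j, Rabs (u j) <= k * Rabs (PS_derive (tri (theta_coef Q)) j * X ^ j)).
  { intros j. unfold u, PS_derive, tri, theta_coef. rewrite !Rabs_mult, <- RPow_abs.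
    rewrite <- (Rmult_assoc k). set (m := (S j * (S j + 1) / 2)%nat).
    pose proof (pos_INR m). pose proof (pos_INR (S j)).
    assert (0 <= Q ^ m) by (apply pow_le; lra).
    apply Rmult_le_compat.
    - apply Rabs_pos.
    - apply pow_le, Rabs_pos.
    - rewrite (Rabs_pos_eq (INR (S j))), (Rabs_pos_eq (INR m)), (Rabs_pos_eq (Q ^ m)) by assumption.
      replace (1 * (INR (S j) * q ^ m) + -1 * (INR (S j) * q0 ^ m)) with
        (INR (S j) * (q ^ m - q0 ^ m)) by ring.
      rewrite Rabs_mult, (Rabs_pos_eq (INR (S j))) by assumption.
      replace (k * (INR (S j) * (INR m * Q ^ m))) with
        (INR (S j) * (INR m * Q ^ m * k)) by ring.
      apply Rmult_le_compat_l; [assumption|]. apply pow_lipschitz; unfold Q in *; lra.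
    - rewrite (Rabs_pos_eq (X ^ j)) by (apply pow_le; lra).
      apply pow_incr. split; [apply Rabs_pos | exact HxX]. }
  destruct (Series_Rabs_le u _ Hu) as [_ Hsum].
  { apply (@ex_series_scal R_AbsRing R_NormedModule). apply HeQ. }
  rewrite Series_scal_l in Hsum. fold C in Hsum.
  assert (Eu : Series u = 1 * PSeries (PS_derive (theta_coef q)) x +
                 -1 * PSeries (PS_derive (theta_coef q0)) x).
  { rewrite <- PSeries_lin by (apply entire_derive, theta_coef_entire; lra).
    reflexivity. }
  rewrite Eu in Hsum.
  assert (HkC : k * C < eps / 2).
  { assert (Hkb : k < eps / 2 / (C + 1)).
    { unfold k. apply Rlt_div_l; [lra|].
      replace (eps / 2 / (C + 1) * Q) with (eps / 2 * Q / (C + 1)) by (field; lra). lra. }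
    apply Rlt_div_r in Hkb; [|lra]. nra. }
  apply Rabs_le_between in Hsum. apply Rabs_def2 in D1. apply Rabs_def1; lra.
Qed.

End TwoVariables.

(** * Complex differentiability *)

Definition cseries (a : nat -> R) (w : C) : C :=
  (Series (fun j => a j * Re (w ^ j)%C), Series (fun j => a j * Im (w ^ j)%C)).

Lemma re_le_Cmod (w : C) : Rabs (Re w) <= Cmod w.
Proof. eapply Rle_trans; [apply Rmax_l | apply Rmax_Cmod]. Qed.

Lemma im_le_Cmod (w : C) : Rabs (Im w) <= Cmod w.
Proof. eapply Rle_trans; [apply Rmax_r | apply Rmax_Cmod]. Qed.

Lemma Cmod_le_re_im (w : C) : Cmod w <= Rabs (Re w) + Rabs (Im w).
Proof.
  replace w with (RtoC (Re w) + Ci * RtoC (Im w))%C at 1.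
  - eapply Rle_trans; [apply Cmod_triangle|].
    rewrite Cmod_mult, !Cmod_R, Cmod_Ci. lra.
  - destruct w as [a b]. unfold RtoC, Ci, Cplus, Cmult, Re, Im; simpl. f_equal; ring.
Qed.

Lemma Cmod_sub_le (w w0 : C) : Cmod w <= Cmod (w - w0) + Cmod w0.
Proof.
  replace w with (w - w0 + w0)%C at 1 by ring. apply Cmod_triangle.
Qed.

Definition cpow_rem (w0 w : C) (j : nat) : C :=
  (w ^ j - w0 ^ j - RtoC (INR j) * ((w - w0) * w0 ^ pred j))%C.

(** The remainders [R_j] satisfy [R_(j+1) = w R_j + j (w - w0)^2 w0^(j-1)]. The condition [1 <= r]
    allows [r^(j-1)] to be replaced by [r^(j+1)], and the factor [j^2] becomes a double application
    of [euler]. *)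
Lemma cpow_rem_bound (w0 w : C) (r : R) (j : nat) : 1 <= r ->
  Cmod w0 <= r -> Cmod w <= r ->
  Cmod (cpow_rem w0 w j) <= INR j * INR j * r ^ j * Cmod (w - w0) ^ 2.
Proof.
  intros Hr H0 H1. set (h := Cmod (w - w0)).
  assert (Hh : 0 <= h) by apply Cmod_ge_0.
  induction j as [|j IH].
  - unfold cpow_rem. simpl. replace (_ - _ - _)%C with (RtoC 0) by ring.
    rewrite Cmod_0. lra.
  - replace (cpow_rem w0 w (S j)) with
      (w * cpow_rem w0 w j + RtoC (INR j) * ((w - w0) * (w - w0) * w0 ^ pred j))%C.
    2:{ unfold cpow_rem. rewrite S_INR, RtoC_plus. destruct j as [|j].
        - simpl. ring.
        - simpl pred. rewrite !Cpow_S. ring. }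
    eapply Rle_trans; [apply Cmod_triangle|]. rewrite !Cmod_mult, Cmod_R, Cmod_pow.
    fold h. pose proof (pos_INR j) as Hj. rewrite (Rabs_pos_eq (INR j)) by exact Hj.
    assert (Hr0 : 0 <= r ^ j) by (apply pow_le; lra).
    assert (A1 : Cmod w * Cmod (cpow_rem w0 w j) <= r * (INR j * INR j * r ^ j * h ^ 2)).
    { apply Rmult_le_compat; try apply Cmod_ge_0; assumption. }
    assert (A2 : Cmod w0 ^ pred j <= r * r ^ j).
    { apply Rle_trans with (r ^ pred j).
      - apply pow_incr. split; [apply Cmod_ge_0 | exact H0].
      - change (r * r ^ j) with (r ^ S j). apply Rle_pow; [exact Hr | lia]. }
    assert (A3 : INR j * (h * h * Cmod w0 ^ pred j) <= INR j * (h * h * (r * r ^ j))).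
    { apply Rmult_le_compat_l; [exact Hj|]. apply Rmult_le_compat_l; [nra | exact A2]. }
    assert (A4 : 0 <= (INR j + 1) * (h * h * (r * r ^ j))).
    { apply Rmult_le_pos; [lra|]. apply Rmult_le_pos; nra. }
    rewrite S_INR. simpl (r ^ S j).
    replace ((INR j + 1) * (INR j + 1) * (r * r ^ j) * h ^ 2) with
      (r * (INR j * INR j * r ^ j * h ^ 2) + INR j * (h * h * (r * r ^ j)) +
       (INR j + 1) * (h * h * (r * r ^ j))) by ring.
    lra.
Qed.

Section ComplexSeries.

Variable a : nat -> R.
Hypothesis Ha : entire a.

Lemma ex_cseries_re (w : C) : ex_series (fun j => a j * Re (w ^ j)%C).
Proof.
  apply (Series_Rabs_le _ (fun j => Rabs (a j * Cmod w ^ j))); [|apply Ha].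
  intros n. rewrite !Rabs_mult. apply Rmult_le_compat_l; [apply Rabs_pos|].
  rewrite <- Cmod_pow. eapply Rle_trans; [apply re_le_Cmod | apply Rle_abs].
Qed.

Lemma ex_cseries_im (w : C) : ex_series (fun j => a j * Im (w ^ j)%C).
Proof.
  apply (Series_Rabs_le _ (fun j => Rabs (a j * Cmod w ^ j))); [|apply Ha].
  intros n. rewrite !Rabs_mult. apply Rmult_le_compat_l; [apply Rabs_pos|].
  rewrite <- Cmod_pow. eapply Rle_trans; [apply im_le_Cmod | apply Rle_abs].
Qed.

End ComplexSeries.

Lemma Series_lin4 (u1 u2 u3 u4 : nat -> R) (k3 k4 : R) :
  ex_series u1 -> ex_series u2 -> ex_series u3 -> ex_series u4 ->
  Series (fun j => u1 j - u2 j - (k3 * u3 j + k4 * u4 j)) =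
  Series u1 - Series u2 - (k3 * Series u3 + k4 * Series u4).
Proof.
  intros H1 H2 H3 H4.
  assert (H34 : ex_series (fun j => k3 * u3 j + k4 * u4 j)).
  { apply (@ex_series_plus R_AbsRing R_NormedModule);
      now apply (@ex_series_scal R_AbsRing R_NormedModule). }
  rewrite Series_minus; [|now apply (@ex_series_minus R_AbsRing R_NormedModule) | exact H34].
  rewrite Series_minus by assumption.
  rewrite Series_plus by now apply (@ex_series_scal R_AbsRing R_NormedModule).
  now rewrite !Series_scal_l.
Qed.

Lemma Series_shift_derive (a p : nat -> R) :
  ex_series (fun j => PS_derive a j * p j) ->
  ex_series (fun j => a j * (INR j * p (pred j))) /\
  Series (fun j => a j * (INR j * p (pred j))) = Series (fun j => PS_derive a j * p j).
Proof.
  intros H.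
  assert (E : forall j, PS_derive a j * p j = a (S j) * (INR (S j) * p (pred (S j))))
    by (intros; unfold PS_derive; simpl pred; ring).
  assert (Hex : ex_series (fun j => a j * (INR j * p (pred j)))).
  { apply (ex_series_incr_1 (fun j => a j * (INR j * p (pred j)))).
    now apply (ex_series_ext _ _ E). }
  split; [exact Hex|]. rewrite (Series_ext _ _ E), Series_incr_1 by exact Hex.
  simpl (INR 0). ring.
Qed.

Lemma cseries_rem_bound (a : nat -> R) (w0 w : C) (r : R) : entire a -> 1 <= r ->
  Cmod w0 <= r -> Cmod w <= r ->
  Cmod (cseries a w - cseries a w0 - (w - w0) * cseries (PS_derive a) w0) <=
  2 * Series (fun j => Rabs (euler (euler a) j * r ^ j)) * Cmod (w - w0) ^ 2.
Proof.
  intros Ha Hr H0 H1.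
  set (h := (w - w0)%C).
  assert (Hd := entire_derive a Ha).
  destruct (Series_shift_derive a (fun j => Re (w0 ^ j)%C) (ex_cseries_re _ Hd w0)) as [X1 E1].
  destruct (Series_shift_derive a (fun j => Im (w0 ^ j)%C) (ex_cseries_im _ Hd w0)) as [X2 E2].
  assert (He : entire (euler (euler a))) by auto using entire_euler.
  assert (Hb : forall p : C -> R, (forall z, Rabs (p z) <= Cmod z) ->
    Rabs (Series (fun j => a j * p (cpow_rem w0 w j))) <=
    Cmod h ^ 2 * Series (fun j => Rabs (euler (euler a) j * r ^ j))).
  { intros p Hp. rewrite <- Series_scal_l. apply Series_Rabs_le.
    - intros j. rewrite Rabs_mult.
      pose proof (cpow_rem_bound w0 w r j Hr H0 H1) as B. fold h in B.
      eapply Rle_trans; [apply Rmult_le_compat_l; [apply Rabs_pos|];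
        eapply Rle_trans; [apply Hp | exact B]|].
      unfold euler. rewrite !Rabs_mult, (Rabs_pos_eq (INR j)) by apply pos_INR.
      rewrite (Rabs_pos_eq (r ^ j)) by (apply pow_le; lra). right. ring.
    - apply (@ex_series_scal R_AbsRing R_NormedModule). apply He. }
  pose proof (Hb Re re_le_Cmod) as B1. pose proof (Hb Im im_le_Cmod) as B2.
  eapply Rle_trans; [apply Cmod_le_re_im|].
  replace (Re (cseries a w - cseries a w0 - h * cseries (PS_derive a) w0)) with
    (Series (fun j => a j * Re (cpow_rem w0 w j))).
  2:{ rewrite (Series_ext _ (fun j => a j * Re (w ^ j)%C - a j * Re (w0 ^ j)%C -
        (Re h * (a j * (INR j * Re (w0 ^ pred j)%C)) +
         - Im h * (a j * (INR j * Im (w0 ^ pred j)%C))))).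
      - rewrite Series_lin4; auto using ex_cseries_re.
        rewrite E1, E2. unfold cseries, Cminus, Cplus, Copp, Cmult, Re, Im. simpl. ring.
      - intros j. unfold cpow_rem. fold h.
        destruct (w ^ j)%C, (w0 ^ j)%C, (w0 ^ pred j)%C, h.
        unfold Cminus, Cplus, Copp, Cmult, RtoC, Re, Im. simpl. ring. }
  replace (Im (cseries a w - cseries a w0 - h * cseries (PS_derive a) w0)) with
    (Series (fun j => a j * Im (cpow_rem w0 w j))).
  2:{ rewrite (Series_ext _ (fun j => a j * Im (w ^ j)%C - a j * Im (w0 ^ j)%C -
        (Im h * (a j * (INR j * Re (w0 ^ pred j)%C)) +
         Re h * (a j * (INR j * Im (w0 ^ pred j)%C))))).
      - rewrite Series_lin4; auto using ex_cseries_im.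
        rewrite E1, E2. unfold cseries, Cminus, Cplus, Copp, Cmult, Re, Im. simpl. ring.
      - intros j. unfold cpow_rem. fold h.
        destruct (w ^ j)%C, (w0 ^ j)%C, (w0 ^ pred j)%C, h.
        unfold Cminus, Cplus, Copp, Cmult, RtoC, Re, Im. simpl. ring. }
  lra.
Qed.

Lemma is_derive_cseries (a : nat -> R) (w0 : C) : entire a ->
  is_derive (K := C_AbsRing) (V := C_NormedModule) (cseries a) w0
    (cseries (PS_derive a) w0).
Proof.
  intros Ha. split; [apply (@is_linear_scal_l C_AbsRing C_NormedModule)|].
  intros x Hx.
  apply (@is_filter_lim_locally_unique C_AbsRing (AbsRing_NormedModule C_AbsRing)) in Hx.
  rewrite <- Hx. clear x Hx. intros eps.
  set (r := Cmod w0 + 1).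
  set (K := 2 * Series (fun j => Rabs (euler (euler a) j * r ^ j))).
  assert (HK : 0 <= K).
  { assert (He : entire (euler (euler a))) by auto using entire_euler.
    apply Rmult_le_pos; [lra|]. apply Series_nonneg; [intros; apply Rabs_pos | apply He]. }
  pose proof (cond_pos eps) as Heps.
  assert (Hd : 0 < Rmin 1 (eps / (K + 1))).
  { apply Rmin_glb_lt; [lra | apply Rdiv_lt_0_compat; lra]. }
  exists (mkposreal _ Hd). intros w Hw. change (Cmod (w - w0) < Rmin 1 (eps / (K + 1))) in Hw.
  change (Cmod (cseries a w - cseries a w0 - (w - w0) * cseries (PS_derive a) w0) <=
          eps * Cmod (w - w0)).
  pose proof (Rmin_l 1 (eps / (K + 1))). pose proof (Rmin_r 1 (eps / (K + 1))).
  pose proof (Cmod_ge_0 w0). pose proof (Cmod_ge_0 (w - w0)) as Hh.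
  assert (HwR : Cmod w <= r).
  { unfold r. pose proof (Cmod_sub_le w w0). lra. }
  pose proof (cseries_rem_bound a w0 w r Ha ltac:(unfold r; lra) ltac:(unfold r; lra) HwR) as B.
  fold K in B.
  assert (Hk : Cmod (w - w0) * (K + 1) < eps) by (apply Rlt_div_r; lra).
  set (h := Cmod (w - w0)) in *. simpl in B. nra.
Qed.

Lemma cseries_real (a : nat -> R) (x : R) : cseries a (RtoC x) = RtoC (PSeries a x).
Proof.
  unfold cseries, PSeries, RtoC at 3. f_equal.
  - apply Series_ext. intros n. now rewrite <- RtoC_pow.
  - rewrite <- (Rmult_0_l (Series (fun _ => 0))), <- Series_scal_l.
    apply Series_ext. intros n. rewrite <- RtoC_pow. simpl. ring.
Qed.

(** [zero_order_ge] asks for a complex derivative on the whole plane, hence the complex series; on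
    the real axis its termwise derivative is the real one. *)
Lemma real_multiple_zero (q x : R) : 0 < q < 1 ->
  PSeries (theta_coef q) x = 0 -> PSeries (PS_derive (theta_coef q)) x = 0 ->
  multiple_zero (theta q) (RtoC x).
Proof.
  intros Hq H0 H1.
  exists (fun n => match n with 0%nat => theta q | _ => cseries (PS_derive (theta_coef q)) end).
  split; [reflexivity|]. split.
  - intros n w Hn. replace n with 0%nat by lia.
    apply is_derive_cseries. now apply theta_coef_entire.
  - intros n Hn. destruct n as [|n].
    + now rewrite theta_real, H0.
    + now rewrite cseries_real, H1.
Qed.

(** * The labelled zeros *)

Lemma is_derive_pos_local (f : R -> R) (a l : R) : is_derive f a l -> 0 < l ->
  exists d, 0 < d /\ (forall t, a < t < a + d -> f a < f t) /\
                     (forall t, a - d < t < a -> f t < f a).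
Proof.
  intros D Hl. apply is_derive_Reals in D.
  destruct (D l Hl) as [d Hd]. exists d. split; [apply cond_pos|].
  assert (Hq : forall h, h <> 0 -> Rabs h < d -> 0 < (f (a + h) - f a) / h).
  { intros h Hh Hhd. specialize (Hd h Hh Hhd). apply Rabs_def2 in Hd. lra. }
  split; intros t Ht.
  - specialize (Hq (t - a) ltac:(lra)). rewrite Rabs_pos_eq in Hq by lra.
    replace (a + (t - a)) with t in Hq by ring.
    pose proof (Rmult_lt_compat_r (t - a) _ _ ltac:(lra) (Hq ltac:(lra))) as H.
    replace ((f t - f a) / (t - a) * (t - a)) with (f t - f a) in H by (field; lra). lra.
  - specialize (Hq (t - a) ltac:(lra)). rewrite Rabs_left in Hq by lra.
    replace (a + (t - a)) with t in Hq by ring.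
    pose proof (Rmult_lt_compat_r (a - t) _ _ ltac:(lra) (Hq ltac:(lra))) as H.
    replace ((f t - f a) / (t - a) * (a - t)) with (f a - f t) in H by (field; lra). lra.
Qed.

Lemma zero_right (f : R -> R) (a b l : R) : continuity f -> a < b ->
  f a = 0 -> is_derive f a l -> 0 < l -> f b < 0 -> exists c, a < c < b /\ f c = 0.
Proof.
  intros Hc Hab Ha D Hl Hb.
  destruct (is_derive_pos_local f a l D Hl) as (d & Hd & Hr & _).
  pose (t := a + Rmin d (b - a) / 2).
  assert (Hm : 0 < Rmin d (b - a)) by (apply Rmin_glb_lt; lra).
  pose proof (Rmin_l d (b - a)). pose proof (Rmin_r d (b - a)).
  assert (Ht : 0 < f t) by (rewrite <- Ha; apply Hr; unfold t; lra).
  destruct (IVT_cor f t b Hc) as [c [Hc1 Hc2]].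
  - unfold t; lra.
  - nra.
  - exists c. split; [|exact Hc2]. split; [unfold t in Hc1; lra|].
    destruct Hc1 as [_ [H1|H1]]; [exact H1|]. subst c. lra.
Qed.

Lemma zero_between (f : R -> R) (a b la lb : R) : continuity f -> a < b ->
  f a = 0 -> f b = 0 -> is_derive f a la -> is_derive f b lb ->
  0 < la -> 0 < lb -> exists c, a < c < b /\ f c = 0.
Proof.
  intros Hc Hab Ha Hb Da Db Hla Hlb.
  destruct (is_derive_pos_local f b lb Db Hlb) as (d & Hd & _ & Hl).
  pose (t := b - Rmin d (b - a) / 2).
  assert (Hm : 0 < Rmin d (b - a)) by (apply Rmin_glb_lt; lra).
  pose proof (Rmin_l d (b - a)). pose proof (Rmin_r d (b - a)).
  assert (Ht : f t < 0) by (rewrite <- Hb; apply Hl; unfold t; lra).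
  destruct (zero_right f a t la Hc) as [c [Hc1 Hc2]]; try assumption; [unfold t; lra|].
  exists c. split; [unfold t in Hc1; lra | exact Hc2].
Qed.

Section Labelling.

Variables (tq : nat -> R) (xi : nat -> R -> C).
Hypothesis H : theta_zero_labelling tq xi.

Let Phi (q x : R) : R := PSeries (theta_coef q) x.
Let dPhi (q x : R) : R := PSeries (PS_derive (theta_coef q)) x.

Lemma is_derive_Phi (q x : R) : 0 < q < 1 -> is_derive (Phi q) x (dPhi q x).
Proof. intros Hq. apply is_derive_entire. now apply theta_coef_entire. Qed.

Lemma continuity_Phi (q : R) : 0 < q < 1 -> continuity (Phi q).
Proof.
  intros Hq x. apply continuity_pt_filterlim.
  apply (@ex_derive_continuous R_AbsRing R_NormedModule).
  eexists. now apply is_derive_Phi.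
Qed.

Lemma theta_ge_1 (q x : R) : 0 < q < 1 -> 0 <= x -> 1 <= Phi q x.
Proof.
  intros Hq Hx. unfold Phi.
  assert (He := theta_coef_entire q Hq).
  unfold PSeries. rewrite Series_incr_1 by now apply entire_ex_series.
  change (theta_coef q 0 * x ^ 0) with (1 * 1).
  assert (0 <= Series (fun k => theta_coef q (S k) * x ^ S k)).
  { apply Series_nonneg.
    - intros n. apply Rmult_le_pos; [apply Rlt_le, theta_coef_pos, Hq | now apply pow_le].
    - apply (ex_series_incr_1 (fun k => theta_coef q k * x ^ k)).
      now apply entire_ex_series. }
  lra.
Qed.

Lemma tq_lt (M N : nat) : (1 <= M < N)%nat -> tq M < tq N.
Proof.
  intros HMN. induction N as [|N IH]; [lia|].
  destruct (Nat.eq_dec M N) as [->|Hn].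
  - apply (tq_increasing _ _ H). lia.
  - apply Rlt_trans with (tq N); [apply IH; lia|]. apply (tq_increasing _ _ H). lia.
Qed.

Lemma tq_le (M N : nat) : (1 <= M <= N)%nat -> tq M <= tq N.
Proof.
  intros HMN. destruct (Nat.eq_dec M N) as [->|Hn]; [lra|].
  apply Rlt_le, tq_lt. lia.
Qed.

Lemma tq_range (N : nat) : (1 <= N)%nat -> 0 < tq N < 1.
Proof.
  intros HN. destruct (proj2 (tq_spectrum _ _ H (tq N))) as [Hr _]; [|exact Hr].
  now exists N.
Qed.

Lemma Phi_zero (q : R) (z : C) : theta q z = 0 -> Im z = 0 -> Phi q (Re z) = 0.
Proof.
  intros Hz Hi.
  assert (E : z = RtoC (Re z)) by (destruct z; simpl in *; now subst).
  rewrite E, theta_real in Hz. unfold Phi. now apply RtoC_inj.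
Qed.

Lemma initial_order_lt (q : R) (i j : nat) : 0 < q < tq 1%nat -> (1 <= i < j)%nat ->
  Re (xi j q) < Re (xi i q).
Proof.
  intros Hq Hij. induction j as [|j IH]; [lia|].
  destruct (Nat.eq_dec i j) as [->|Hn].
  - apply (xi_initial_order _ _ H q Hq j). lia.
  - apply Rlt_trans with (Re (xi j q)); [|apply IH; lia].
    apply (xi_initial_order _ _ H q Hq j). lia.
Qed.

Lemma initial_simple (q x : R) : 0 < q < tq 1%nat -> Phi q x = 0 -> dPhi q x <> 0.
Proof.
  intros Hq H0 H1. pose proof (tq_range 1 (le_n 1)) as Hr.
  assert (Hs : spectrum q).
  { split; [lra|]. exists (RtoC x). apply real_multiple_zero; [lra | exact H0 | exact H1]. }
  apply (tq_spectrum _ _ H) in Hs. destruct Hs as (N & HN & E).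
  pose proof (tq_le 1 N ltac:(lia)). lra.
Qed.

Lemma initial_no_zero_between (q c : R) (j : nat) : 0 < q < tq 1%nat -> (1 <= j)%nat ->
  Re (xi (S j) q) < c < Re (xi j q) -> Phi q c <> 0.
Proof.
  intros Hq Hj Hc H0.
  assert (Hz : theta q (RtoC c) = 0) by (rewrite theta_real; now f_equal).
  apply (xi_initial_all _ _ H q Hq) in Hz. destruct Hz as (i & Hi & E).
  assert (Ec : c = Re (xi i q)) by now rewrite <- E.
  destruct (Nat.lt_trichotomy i j) as [Hij|[->|Hij]].
  - pose proof (initial_order_lt q i j Hq ltac:(lia)). lra.
  - lra.
  - destruct (Nat.eq_dec i (S j)) as [->|Hn]; [lra|].
    pose proof (initial_order_lt q (S j) i Hq ltac:(lia)). lra.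
Qed.

(** The first zero has positive derivative, since otherwise theta, which is at least 1 at 0, would
    vanish once more in between. Two neighbouring simple zeros with derivatives of equal sign would
    enclose another zero. *)
Lemma initial_derive_sign (q : R) (j : nat) : 0 < q < tq 1%nat ->
  (-1) ^ S j * dPhi q (Re (xi (S j) q)) < 0.
Proof.
  intros Hq. pose proof (tq_range 1 (le_n 1)) as Hr.
  assert (Hq1 : 0 < q < 1) by lra.
  assert (Hz : forall i, Phi q (Re (xi (S i) q)) = 0).
  { intros i. destruct (xi_initial_order _ _ H q Hq (S i)) as [Hi _]; [lia|].
    apply Phi_zero; [|exact Hi]. apply (xi_zero _ _ H); [lia | exact Hq1]. }
  assert (Hs : forall i, dPhi q (Re (xi (S i) q)) <> 0)
    by (intros; now apply initial_simple).
  assert (Dopp : forall x, is_derive (fun t => - Phi q t) x (- dPhi q x)).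
  { intros x. apply (@is_derive_opp R_AbsRing R_NormedModule). now apply is_derive_Phi. }
  assert (Copp : continuity (fun t => - Phi q t))
    by (apply continuity_opp, continuity_Phi; exact Hq1).
  induction j as [|j IH].
  - enough (~ dPhi q (Re (xi 1%nat q)) < 0) by (specialize (Hs 0%nat); simpl; lra).
    intros Hneg.
    destruct (xi_initial_order _ _ H q Hq 1%nat) as (_ & Hn & _); [lia|].
    destruct (zero_right (fun t => - Phi q t) (Re (xi 1%nat q)) 0
      (- dPhi q (Re (xi 1%nat q))) Copp Hn) as [c [Hc1 Hc2]].
    + rewrite Hz. ring.
    + apply Dopp.
    + lra.
    + pose proof (theta_ge_1 q 0 Hq1 (Rle_refl 0)). lra.
    + assert (Hc0 : theta q (RtoC c) = 0) by (rewrite theta_real; f_equal; fold (Phi q c); lra).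
      apply (xi_initial_all _ _ H q Hq) in Hc0. destruct Hc0 as (i & Hi & E).
      assert (Ec : c = Re (xi i q)) by now rewrite <- E.
      destruct (Nat.eq_dec i 1) as [->|Hi1]; [lra|].
      pose proof (initial_order_lt q 1 i Hq ltac:(lia)). lra.
  - assert (Hlt : Re (xi (S (S j)) q) < Re (xi (S j) q)) by (apply initial_order_lt; [auto | lia]).
    assert (Hopp : dPhi q (Re (xi (S (S j)) q)) * dPhi q (Re (xi (S j) q)) < 0).
    { pose proof (Hs j) as Hs1. pose proof (Hs (S j)) as Hs2.
      destruct (Rtotal_order (dPhi q (Re (xi (S j) q))) 0) as [A|[A|A]];
        destruct (Rtotal_order (dPhi q (Re (xi (S (S j)) q))) 0) as [B|[B|B]];
        try contradiction; try nra; exfalso.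
      - destruct (zero_between (fun t => - Phi q t) _ _ _ _ Copp Hlt
          ltac:(cbv beta; rewrite Hz; ring) ltac:(cbv beta; rewrite Hz; ring)
          (Dopp _) (Dopp _) ltac:(lra) ltac:(lra)) as [c [Hc1 Hc2]].
        apply (initial_no_zero_between q c (S j)); [auto | lia | auto | lra].
      - destruct (zero_between (Phi q) _ _ _ _ (continuity_Phi q Hq1) Hlt
          (Hz (S j)) (Hz j) (is_derive_Phi q _ Hq1) (is_derive_Phi q _ Hq1) B A) as [c [Hc1 Hc2]].
        apply (initial_no_zero_between q c (S j)); [auto | lia | auto | auto]. }
    replace ((-1) ^ S (S j)) with (- (-1) ^ S j) by (simpl; ring).
    assert (Hp : (-1) ^ S j * (-1) ^ S j = 1).
    { rewrite <- Rpow_mult_distr. replace (-1 * -1) with 1 by ring. apply pow1. }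
    nra.
Qed.

(** * Monotonicity of one even zero *)

Variable k : nat.
Hypothesis Hk : (1 <= k)%nat.

Let x (q : R) : R := Re (xi (2 * k)%nat q).

Lemma even_zero (q : R) : 0 < q <= tq k -> Phi q (x q) = 0.
Proof.
  intros Hq. pose proof (tq_range k Hk).
  apply Phi_zero; [apply (xi_zero _ _ H); [lia | lra]|].
  now apply (xi_even_real _ _ H).
Qed.

Lemma even_zero_neg (q : R) : 0 < q <= tq k -> x q < 0.
Proof.
  intros Hq. pose proof (tq_range k Hk).
  destruct (Rlt_le_dec (x q) 0) as [Hx|Hx]; [exact Hx|].
  pose proof (theta_ge_1 q (x q) ltac:(lra) Hx). rewrite even_zero in *; lra.
Qed.

Lemma spectral_order_lt (N i j : nat) : (1 <= N)%nat -> (2 * N <= i < j)%nat ->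
  Re (xi j (tq N)) < Re (xi i (tq N)).
Proof.
  intros HN Hij. induction j as [|j IH]; [lia|].
  destruct (Nat.eq_dec i j) as [->|Hn].
  - apply (xi_spectral_order _ _ H N j HN). lia.
  - apply Rlt_trans with (Re (xi j (tq N))); [|apply IH; lia].
    apply (xi_spectral_order _ _ H N j HN). lia.
Qed.

(** A multiple zero would make [q] some [tq N] with [N < k]. There the only real multiple zero is
    [xi (2N)], and [xi (2k)] lies strictly to its left. *)
Lemma even_zero_simple (q : R) : 0 < q < tq k -> dPhi q (x q) <> 0.
Proof.
  intros Hq Hd. pose proof (tq_range k Hk).
  pose proof (real_multiple_zero q (x q) ltac:(lra) (even_zero q ltac:(lra)) Hd) as Hm.
  assert (Hs : spectrum q) by (split; [lra | now exists (RtoC (x q))]).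
  apply (tq_spectrum _ _ H) in Hs. destruct Hs as (N & HN & ->).
  destruct (Nat.le_gt_cases k N) as [HkN|HkN].
  - pose proof (tq_le k N ltac:(lia)). lra.
  - apply (xi_spectral_unique _ _ H N _ HN) in Hm.
    pose proof (spectral_order_lt N (2 * N) (2 * k) HN ltac:(lia)) as Hlt.
    rewrite <- Hm in Hlt. fold (x (tq N)) in Hlt. simpl in Hlt. lra.
Qed.

Lemma even_zero_continuous (q : R) : 0 < q < 1 -> continuous x q.
Proof.
  intros Hq. unfold x, Re.
  apply (continuous_comp (xi (2 * k)%nat) (fun p : R * R => fst p)).
  - apply (xi_continuous _ _ H); [lia | exact Hq].
  - apply continuous_fst.
Qed.

Lemma even_zero_near (q e : R) : 0 < q < 1 -> 0 < e ->
  exists d, 0 < d /\ forall p, Rabs (p - q) < d -> Rabs (x p - x q) < e.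
Proof.
  intros Hq He.
  destruct (even_zero_continuous q Hq _ (locally_ball _ (mkposreal e He))) as [d Hd].
  exists d. split; [apply cond_pos | exact Hd].
Qed.

Lemma even_derive_continuous (q : R) : 0 < q < 1 ->
  continuity_pt (fun q => dPhi q (x q)) q.
Proof.
  intros Hq e He.
  destruct (theta_derive_continuous q Hq (x q) e He) as (d1 & Hd1 & C1).
  destruct (even_zero_near q d1 Hq Hd1) as (d2 & Hd2 & C2).
  exists (Rmin d1 d2). split; [now apply Rmin_glb_lt|].
  intros p [_ Hp]. change (Rabs (p - q) < Rmin d1 d2) in Hp.
  change (Rabs (dPhi p (x p) - dPhi q (x q)) < e).
  pose proof (Rmin_l d1 d2). pose proof (Rmin_r d1 d2).
  apply C1; [lra | apply C2; lra].
Qed.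

Lemma even_derive_neg (q : R) : 0 < q < tq k -> dPhi q (x q) < 0.
Proof.
  intros Hq. pose proof (tq_range k Hk). pose proof (tq_range 1 (le_n 1)).
  destruct (Rtotal_order (dPhi q (x q)) 0) as [A|[A|A]]; [exact A| |].
  - now apply even_zero_simple in A.
  - exfalso. pose (p := Rmin q (tq 1%nat) / 2).
    pose proof (Rmin_l q (tq 1%nat)). pose proof (Rmin_r q (tq 1%nat)).
    assert (0 < Rmin q (tq 1%nat)) by (apply Rmin_glb_lt; lra).
    assert (Hp : dPhi p (x p) < 0).
    { pose proof (initial_derive_sign p (pred (2 * k)) ltac:(unfold p; lra)) as Hsgn.
      replace (S (pred (2 * k))) with (2 * k)%nat in Hsgn by lia.
      rewrite pow_1_even in Hsgn. fold (x p) in Hsgn. lra. }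
    destruct (IVT_interv (fun q => dPhi q (x q)) p q) as [c [Hc1 Hc2]].
    + intros c Hc. apply even_derive_continuous. unfold p in Hc; lra.
    + unfold p; lra.
    + exact Hp.
    + exact A.
    + revert Hc2. apply even_zero_simple. unfold p in Hc1; split; [lra|].
      destruct Hc1 as [_ Hc1]. lra.
Qed.

(** For [q] slightly above [p], theta is positive at the old position [x p]. If [x q] lay to the
    left, the mean value theorem would give a positive slope between [x q] and [x p]; but
    continuity, with tolerance [- dPhi p (x p)], keeps the slope negative there. *)
Lemma even_zero_locally_increasing (p : R) : 0 < p < tq k ->
  exists d, 0 < d /\ forall q, p < q < p + d -> x p < x q.
Proof.
  intros Hp. pose proof (tq_range k Hk) as Hr.
  assert (Hp1 : 0 < p < 1) by lra.
  pose proof (even_zero p ltac:(lra)) as H0.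
  pose proof (even_zero_neg p ltac:(lra)) as Hneg.
  pose proof (even_derive_neg p Hp) as Hd.
  destruct (theta_increasing_in_q p Hp1 (x p)) as (d1 & Hd1 & I1).
  { assert (He : 0 < PSeries (euler (theta_coef p)) (x p)).
    { rewrite PSeries_euler. fold (dPhi p (x p)). nra. }
    now apply theta_zero_descending. }
  destruct (theta_derive_continuous p Hp1 (x p) (- dPhi p (x p))) as (d2 & Hd2 & C2); [lra|].
  destruct (even_zero_near p d2 Hp1 Hd2) as (d3 & Hd3 & C3).
  exists (Rmin (Rmin d1 d2) (Rmin d3 (tq k - p))). split.
  { repeat apply Rmin_glb_lt; lra. }
  intros q Hq.
  pose proof (Rmin_l (Rmin d1 d2) (Rmin d3 (tq k - p))).
  pose proof (Rmin_r (Rmin d1 d2) (Rmin d3 (tq k - p))).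
  pose proof (Rmin_l d1 d2). pose proof (Rmin_r d1 d2).
  pose proof (Rmin_l d3 (tq k - p)). pose proof (Rmin_r d3 (tq k - p)).
  assert (Hqp : Rabs (q - p) = q - p) by (apply Rabs_pos_eq; lra).
  specialize (I1 q ltac:(lra) ltac:(lra)). fold (Phi p (x p)) (Phi q (x p)) in I1.
  specialize (C3 q ltac:(lra)). apply Rabs_def2 in C3.
  pose proof (even_zero q ltac:(lra)) as Hzq.
  destruct (Rlt_le_dec (x p) (x q)) as [Hlt|[Hlt|Heq]]; [exact Hlt| |].
  - exfalso.
    destruct (MVT_cor2 (Phi q) (dPhi q) (x q) (x p) Hlt) as (c & E & Hc).
    { intros c _. apply is_derive_Reals, is_derive_Phi. lra. }
    assert (Hc2 : Rabs (c - x p) < d2) by (apply Rabs_def1; lra).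
    specialize (C2 q c ltac:(lra) Hc2). fold (dPhi q c) (dPhi p (x p)) in C2.
    apply Rabs_def2 in C2. nra.
  - exfalso. rewrite Heq in Hzq. lra.
Qed.

(** The local statement concerns only [p < tq k], as the zero is double at [tq k]. That is enough:
    no [p < q2] can maximise [x] on the interval from [q1] to [q2], so the maximum, which exists by
    continuity, is attained at [q2] only. *)
Lemma even_zero_increasing (q1 q2 : R) : 0 < q1 -> q1 < q2 -> q2 <= tq k -> x q1 < x q2.
Proof.
  intros H1 H2 H3. pose proof (tq_range k Hk).
  destruct (continuity_ab_maj x q1 q2) as (m & Hm & Hm12); [lra| |].
  { intros c Hc. apply continuity_pt_filterlim, even_zero_continuous. lra. }
  assert (Hmax : forall p, q1 <= p < q2 -> x p < x m).
  { intros p Hp. destruct (even_zero_locally_increasing p) as (d & Hd & Hinc); [lra|].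
    pose (q := p + Rmin d (q2 - p) / 2).
    pose proof (Rmin_l d (q2 - p)). pose proof (Rmin_r d (q2 - p)).
    assert (0 < Rmin d (q2 - p)) by (apply Rmin_glb_lt; lra).
    apply Rlt_le_trans with (x q); [apply Hinc | apply Hm]; unfold q; lra. }
  destruct (Req_dec m q2) as [->|Hne]; [apply Hmax; lra|].
  pose proof (Hmax m ltac:(lra)). lra.
Qed.

End Labelling.

Theorem proposition14 :
  forall (tq : nat -> R) (xi : nat -> R -> C),
    theta_zero_labelling tq xi ->
    forall k : nat, (1 <= k)%nat ->
    forall q1 q2 : R, 0 < q1 -> q1 < q2 -> q2 <= tq k ->
      Re (xi (2 * k)%nat q1) < Re (xi (2 * k)%nat q2).
Proof. exact even_zero_increasing. Qed.
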